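(* Let $n\ge 2$ and let $K$ be an origin symmetric star body in $\mathbb{R}^n$ with Minkowski functional $\|\cdot\|_K$. Suppose there exists an even, non-constant, continuous function $f:\mathbb{R}\to\mathbb{R}$ such that the function $x\mapsto f(\|x\|_K)$ is positive definite on $\mathbb{R}^n$. Then the space $(\mathbb{R}^n,\|\cdot\|_K)$ embeds in $L_0$.
   Context: A closed bounded set $K\subset\mathbb{R}^n$ is a star body if every straight line through the origin crosses the boundary of $K$ at exactly two points, the origin is an interior point of $K$, and the Minkowski functional $\|x\|_K=\min\{s\ge 0: x\in sK\}$ is a continuous function on $\mathbb{R}^n$; it is origin symmetric if $K=-K$. A complex valued function $g$ on $\mathbb{R}^n$ is positive definite if for every finite sequence $x_1,\dots,x_m\in\mathbb{R}^n$ and complex numbers $c_1,\dots,c_m$, $\sum_{i,j=1}^m c_i\bar c_j g(x_i-x_j)\ge 0$. The space $(\mathbb{R}^n,\|\cdot\|_K)$ embeds in $L_0$ if there exist a finite Borel measure $\mu$ on the unit sphere $S^{n-1}$ and a constant $C\in\mathbb{R}$ such that for every $x\in\mathbb{R}^n$, $\ln\|x\|_K=\int_{S^{n-1}}\ln|(x,\xi)|\,d\mu(\xi)+C$, where $(x,\xi)$ is the standard inner product. *)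

(* Defs.v *)
From HB Require Import structures.
From mathcomp Require Import all_boot all_order all_algebra.
From mathcomp Require Import all_classical all_reals all_analysis.
From mathcomp Require Import complex.
Set Implicit Arguments. Unset Strict Implicit. Unset Printing Implicit Defensive.
Import Order.TTheory GRing.Theory Num.Theory.
Import numFieldNormedType.Exports.
Local Open Scope classical_set_scope.
Local Open Scope ring_scope.

Definition inner (R : realType) (n : nat) (x y : 'rV[R]_n) : R :=
  \sum_(i < n) x ord0 i * y ord0 i.

Definition sphere (R : realType) (n : nat) : set 'rV[R]_n :=
  [set xi | inner xi xi = 1].

Definition minkowski_functional (R : realType) (n : nat) (K : set 'rV[R]_n) (x : 'rV[R]_n) : R :=
  inf [set s : R | 0 <= s /\ exists2 y, K y & x = s *: y].

Definition bdry (R : realType) (n : nat) (K : set 'rV[R]_n) : set 'rV[R]_n :=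
  closure K `\` interior K.

Definition star_body (R : realType) (n : nat) (K : set 'rV[R]_n) : Prop :=
  [/\ closed K, bounded_set K,
      (forall u : 'rV[R]_n, u != 0 ->
         exists a b : R, a != b /\
           forall t : R, bdry K (t *: u) <-> (t = a \/ t = b)),
      interior K 0 &
      continuous (minkowski_functional K)].

Definition origin_symmetric (R : realType) (n : nat) (K : set 'rV[R]_n) : Prop :=
  (fun x => - x) @` K = K.

Definition positive_definite (R : realType) (n : nat) (g : 'rV[R]_n -> R[i]) : Prop :=
  forall (m : nat) (x : 'I_m -> 'rV[R]_n) (c : 'I_m -> R[i]),
    0 <= \sum_(i < m) \sum_(j < m) c i * (c j)^* * g (x i - x j).

Definition borel_rV (R : realType) (n : nat) := g_sigma_algebraType (@open 'rV[R]_n).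

Definition elog (R : realType) (t : R) : \bar R :=
  if t == 0 then -oo%E else (ln `|t|)%:E.

(* (R^n, ||.||_K) embeds in L_0: there are a finite Borel measure mu on S^{n-1}
   (a finite Borel measure on R^n carried by S^{n-1}) and C such that
   ln ||x||_K = \int_{S^{n-1}} ln |(x,xi)| dmu(xi) + C for all x. *)
Definition embeds_in_L0 (R : realType) (n : nat) (K : set 'rV[R]_n) : Prop :=
  exists (mu : {finite_measure set (borel_rV R n) -> \bar R}) (C : R),
    mu (~` (@sphere R n)) = 0%E /\
    (forall x : 'rV[R]_n, x != 0 ->
       mu.-integrable (@sphere R n : set (borel_rV R n)) (fun xi => elog (inner x xi))) /\
    (forall x : 'rV[R]_n,
       elog (minkowski_functional K x) =
         (\int[mu]_(xi in (@sphere R n : set (borel_rV R n))) elog (inner x xi) + C%:E)%E).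

(* Main.v *)
(* Normalise f so that f(0) = 1. By Bochner's theorem f(||x||) is the
   characteristic function of a random vector X; since only the real part is
   needed, and on an arbitrary probability space, X is obtained as the standard
   part, on a Loeb space, of the discrete distributions whose weights are
   Fejer means of f(||.||) over finer and finer lattices, tightness coming from
   continuity at 0.

   The law of |(x,X)| then depends on ||x|| only. Integrating the cosine
   transform against explicit kernels, e^(-t) dt and then ds/s on [1/m, m],
   turns 1 - cos(t y) into truncated logarithms of |y|, and monotone convergence
   as m grows shows that Lambda(x) = E ln(|X| / |(x,X)|) depends only on ||x||
   when |x_1| + ... + |x_n| <= 1. Averaging over directions shows that Lambda is
   finite for a generic x. Since Lambda(c x) = Lambda(x) - P(X <> 0) ln c, this
   forces Lambda(x) = A - P(X <> 0) ln ||x|| for all small x <> 0, and the law of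
   X/|X|, restricted to the sphere and scaled by 1 / P(X <> 0), is the required
   measure. *)
Require Import Defs.
From HB Require Import structures.
From mathcomp Require Import all_boot all_order all_algebra.
From mathcomp Require Import all_classical all_reals all_analysis.
From mathcomp Require Import complex.
From mathcomp Require Import measurable_realfun ring lra zify.
Set Implicit Arguments. Unset Strict Implicit. Unset Printing Implicit Defensive.
Import Order.TTheory GRing.Theory Num.Theory.
Import numFieldNormedType.Exports.
Local Open Scope classical_set_scope.
Local Open Scope ring_scope.

(** * Loeb measures *)

(** The obstacle is that [ln |(x,X)|] need not be integrable: nothing controls the law of X at
    infinity, and a priori (x,X) may be small or zero too often for a particular x. Dividing by |X|,
    which is the same for every x, removes the first difficulty. When the coordinates of x have
    absolute sum at most 1, one has |(x,X)| <= |X|, so the logarithm of the ratio is nonnegative and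
    its mean exists in [0, +oo] without any assumption. The second difficulty is why averaging has
    to supply one direction with finite mean; dependence on ||x|| alone then carries finiteness to
    every other direction.

    X may also vanish with positive probability. The logarithm of the ratio is set to 0 there, so
    the slope of Lambda in ln ||x|| is P(X <> 0) instead of 1; it is positive because f is not
    constant.

    The ultrafilter replaces the extraction of a weakly convergent subsequence: all approximations
    live on one space of sequences, where X is an honest random vector. *)

Lemma free_ultrafilter_exists :
  exists U : set_system nat, UltraFilter U /\ \oo `<=` U.
Proof. exact: ultraFilterLemma. Qed.

Definition free_ultra : set_system nat := sval (cid free_ultrafilter_exists).

Global Instance free_ultra_ultra : UltraFilter free_ultra.
Proof. by rewrite /free_ultra; case: cid => /= U []. Qed.

Lemma free_ultra_near (P : set nat) : (\forall N \near \oo, P N) -> free_ultra P.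
Proof. by rewrite /free_ultra; case: cid => /= U [_]; exact. Qed.

Lemma free_ultraNP (P : set nat) : ~ free_ultra P <-> free_ultra (~` P).
Proof.
split=> [nP|UC UP]; first by have [] := in_ultra_setVsetC P free_ultra_ultra.
have PC : free_ultra (P `&` ~` P) by exact: filterI.
by have /filter_ex[N []] := PC.
Qed.

Section ulim.
Context {R : realType}.
Implicit Type u : nat -> R.

Definition ulim u : R := lim (u @ free_ultra).

(** The image ultrafilter lives on the compact segment [[- B, B]], where every ultrafilter
    converges. *)
Lemma ulim_bounded u B : free_ultra [set N | `|u N| <= B] ->
  cvg (u @ free_ultra).
Proof.
move=> uB.
have := @segment_compact R (- B) B; rewrite compact_ultra => /(_ (u @ free_ultra)).
case.
- split; first exact: fmap_proper_filter.
  move=> G GF sG; apply/seteqP; split=> // A GA.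
  have [//|] := in_ultra_setVsetC (u @^-1` A) free_ultra_ultra => nA.
  have /sG GnA : (u @ free_ultra) (~` A) by exact: nA.
  have GAC : G (A `&` ~` A) by exact: filterI.
  by have /filter_ex[x []] := GAC.
- by apply: filterS uB => N /=; rewrite in_itv/= ler_norml.
- by move=> l [_ ul]; apply/cvg_ex; exists l.
Qed.

Lemma ulimP u l : u @ free_ultra --> l -> ulim u = l.
Proof. by move=> ul; apply: cvg_lim. Qed.

Lemma cvg_free_ultra u (l : R) : u @ \oo --> l -> u @ free_ultra --> l.
Proof. by move=> ul A /ul uA; exact: free_ultra_near. Qed.

End ulim.

Section internal_sets.
Context {V : Type}.
Implicit Types A B : nat -> set V.

(** No quotient by the ultrafilter is formed: membership depends only on the class of [w] modulo
    agreement on a set of the ultrafilter, so sequences themselves can serve as points. *)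
Definition internal A : set (nat -> V) := [set w | free_ultra [set N | A N (w N)]].

Lemma internalC A : ~` internal A = internal (fun N => ~` A N).
Proof. by apply/seteqP; split => w; [move/free_ultraNP|move=> ?; apply/free_ultraNP]. Qed.

Lemma internalI A B : internal A `&` internal B = internal (fun N => A N `&` B N).
Proof.
apply/seteqP; split => w; first by move=> [] /filterI /[apply].
by move=> H; split; apply: filterS H => N [].
Qed.

Lemma internalU A B : internal A `|` internal B = internal (fun N => A N `|` B N).
Proof.
rewrite -[LHS]setCK setCU !internalC internalI internalC; congr internal.
by apply/funext => N; rewrite -setCU setCK.
Qed.

Lemma internal0 : internal (fun=> set0) = set0.
Proof. by rewrite -subset0 => w /filter_ex[]. Qed.

Lemma internalT : internal (fun=> setT) = setT.
Proof. by rewrite -subTset => w _; exact: filterT. Qed.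

End internal_sets.

Section saturation.
Context {V : pointedType}.
Implicit Types A B : nat -> set V.

(* Countable saturation: at index N the point [w N] avoids as many of the
   [A k N] as is possible among the first N. *)
Lemma internal_saturation A (F : nat -> nat -> set V) :
  internal A `<=` \bigcup_k internal (F k) ->
  exists K, free_ultra [set N | A N `<=` \bigcup_(k < K) F k N].
Proof.
move=> AF; apply: contrapT => /forallNP nK.
pose good K N := exists v, A N v /\ forall k, (k < K)%N -> ~ F k N v.
have goodU K : free_ultra (good K).
  have /free_ultraNP nKC := nK K; apply: (filterS _ nKC) => N /existsNP[v /not_implyP[Av nF]].
  by exists v; split=> // k kK Fv; apply: nF; exists k.
have wit N : good 0 N -> exists v, A N v /\ forall K, (K <= N)%N -> good K N ->
    forall k, (k < K)%N -> ~ F k N v.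
  move=> g0.
  suff : forall M, exists v, A N v /\ forall K, (K <= M)%N -> good K N ->
    forall k, (k < K)%N -> ~ F k N v by exact.
  elim=> [|M [v [Av IH]]].
    by have [v [Av _]] := g0; exists v; split=> // K; rewrite leqn0 => /eqP ->.
  have [[u [Au uF]]|nM] := pselect (good M.+1 N).
    by exists u; split=> // K KM _ k kK; apply: uF; exact: leq_trans KM.
  exists v; split=> // K; rewrite leq_eqVlt => /orP[/eqP -> //|]; exact: IH.
pose w N := if pselect (good 0 N) is left g then sval (cid (wit N g)) else point.
have [k _ wk] : (\bigcup_k internal (F k)) w.
  apply: AF; apply: filterS (goodU 0%N) => N g0; rewrite /w /=.
  by case: (pselect (good 0%N N)) => [g|/(_ g0)//]; have [] := svalP (cid (wit N g)).
(* The point [w N] takes [good k.+1 N] into account only for indices [N >= k.+1]. *)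
have Ubig : free_ultra [set N | (k.+1 <= N)%N].
  by apply: free_ultra_near; exists k.+1.
have gg : free_ultra ([set N | F k N (w N)] `&` [set N | (k.+1 <= N)%N] `&`
    (good 0%N `&` good k.+1)).
  by apply: filterI; exact: filterI.
have /filter_ex[N [[/= FN kN] [g0 gk]]] := gg.
move: FN; rewrite /w /=; case: (pselect (good 0%N N)) => [g|/(_ g0)//]; have [_ H] := svalP (cid (wit N g)).
exact: (H _ kN gk k (ltnSn k)).
Qed.

Lemma internal_subP A B : internal A `<=` internal B ->
  free_ultra [set N | A N `<=` B N].
Proof.
move=> AB.
have [|K] := @internal_saturation A (fun=> B); first by move=> w /AB; exists 0%N.
by apply: filterS => N AK v /AK[].
Qed.

(** This makes the content below independent of the sequence of sets that represents an internal
    set. *)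
Lemma internal_inj A B : internal A = internal B -> free_ultra [set N | A N = B N].
Proof.
move=> AB.
have AB1 : internal A `<=` internal B by rewrite AB.
have BA : internal B `<=` internal A by rewrite AB.
apply: filterS (filterI (internal_subP AB1) (internal_subP BA)) => N [? ?].
exact/seteqP.
Qed.

End saturation.

(** Finite additivity suffices, because saturation produces countable additivity of the limit. *)
Record faprob (R : realType) (V : Type) := FAProb {
  fap :> set V -> R;
  fap_ge0 : forall A, 0 <= fap A;
  fapT : fap setT = 1;
  fapU : forall A B, A `&` B = set0 -> fap (A `|` B) = fap A + fap B }.

Section faprob_theory.
Context {R : realType} {V : Type} (p : faprob R V).

Lemma fap0 : p set0 = 0.
Proof.
have := @fapU _ _ p set0 set0; rewrite setIid setUid => /(_ erefl)/eqP.
by rewrite -subr_eq0 opprD addNKr oppr_eq0 => /eqP.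
Qed.

Lemma fap_le1 A : p A <= 1.
Proof. by rewrite -(fapT p) -(setUv A) fapU ?setICr// lerDl fap_ge0. Qed.

Lemma fap_norm_le1 A : `|p A| <= 1.
Proof. by rewrite ger0_norm ?fap_ge0 ?fap_le1. Qed.

End faprob_theory.

Definition loeb_space (V : Type) := nat -> V.

Definition loeb_display (V : Type) : measure_display.
Proof. exact: default_measure_display. Qed.

Section loeb_algebra.
Variable V : pointedType.

HB.instance Definition _ := Pointed.on (loeb_space V).

Definition loeb_internal : set (set (loeb_space V)) := range (@internal V).

Lemma loeb_internal0 : loeb_internal set0.
Proof. by exists (fun=> set0) => //; exact: internal0. Qed.

Lemma loeb_internalU : setU_closed loeb_internal.
Proof.
by move=> _ _ [A _ <-] [B _ <-]; exists (fun N => A N `|` B N) => //;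
  rewrite internalU.
Qed.

Lemma loeb_internalC : setC_closed loeb_internal.
Proof.
by move=> _ [A _ <-]; exists (fun N => ~` A N) => //; rewrite internalC.
Qed.

HB.instance Definition _ := @isAlgebraOfSets.Build (loeb_display V) (loeb_space V)
  loeb_internal loeb_internal0 loeb_internalU loeb_internalC.

End loeb_algebra.

Section loeb_content.
Context {R : realType} {V : pointedType} (p : nat -> faprob R V).

Definition internal_rep (S : set (loeb_space V)) : nat -> set V :=
  xget (fun=> set0) [set A | internal A = S].

Definition loeb_content (S : set (loeb_space V)) : \bar R :=
  (ulim (fun N => p N (internal_rep S N)))%:E.

Lemma fap_cvg A : (fun N => p N (A N)) @ free_ultra --> ulim (fun N => p N (A N)).
Proof.
apply: (@ulim_bounded _ _ 1); apply: filterS filterT => N _ /=.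
exact: fap_norm_le1.
Qed.

Lemma loeb_contentE (A : nat -> set V) :
  loeb_content (internal A) = (ulim (fun N => p N (A N)))%:E.
Proof.
congr (_%:E); apply: ulimP.
have /internal_inj AA : internal (internal_rep (internal A)) = internal A.
  exact: (@xgetPex _ (fun=> set0) [set B | internal B = internal A] (ex_intro _ A erefl)).
apply: cvg_trans (fap_cvg (A := A)); apply: near_eq_cvg.
by apply: filterS AA => N /= ->.
Qed.

Lemma loeb_content_ge0 S : (0 <= loeb_content S)%E.
Proof.
rewrite lee_fin; have : cvg ((fun N => p N (internal_rep S N)) @ free_ultra).
  exact: fap_cvg.
by move/limr_ge; apply; apply: filterS filterT => N _ /=; exact: fap_ge0.
Qed.

Lemma loeb_content0 : loeb_content set0 = 0%E.
Proof.
rewrite -internal0 loeb_contentE; congr _%:E; apply: ulimP.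
by under eq_fun do rewrite fap0; exact: cvg_cst.
Qed.

Lemma loeb_content_additive : measure_function.semi_additive loeb_content.
Proof.
apply/(additive2P loeb_content0) => _ _ [A _ <-] [B _ <-].
rewrite internalI -internal0 => /internal_inj AB.
rewrite internalU !loeb_contentE -EFinD; congr _%:E; apply: ulimP.
apply: cvg_trans (cvgD (fap_cvg (A := A)) (fap_cvg (A := B))).
apply: near_eq_cvg; apply: filterS AB => N /= AB; by rewrite fapU.
Qed.

HB.instance Definition _ := isContent.Build _ _ R loeb_content
  loeb_content_ge0 loeb_content_additive.

(** By saturation, an internal set covered by countably many internal sets is covered by finitely
    many of them. A disjoint union that is internal therefore has only finitely many non-empty
    terms, and countable additivity reduces to finite additivity. *)
Lemma loeb_content_sigma_additive : semi_sigma_additive loeb_content.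
Proof.
move=> F mF tF [A _ UF].
have /choice[B FB] i : exists B, internal B = F i.
  by have [B _ <-] := mF i; exists B.
have [K AK] : exists K, free_ultra [set N | A N `<=` \bigcup_(k < K) B k N].
  by apply: internal_saturation; rewrite UF; under eq_bigcupr do rewrite -FB.
have Kbig M : (K <= M)%N -> \bigcup_n F n = \big[setU/set0]_(i < M) F i.
  move=> KM; rewrite -bigcup_mkord; apply/seteqP; split=> [w|w [i _ Fi]]; last by exists i.
  rewrite -UF => Aw.
  have [//|nw] := pselect ((\bigcup_(i < M) F i) w).
  have nwB k : (k < K)%N -> free_ultra [set N | ~ B k N (w N)].
    move=> kK; apply/free_ultraNP => Bw; apply: nw; exists k => /=.
      exact: leq_trans KM.
    by rewrite -FB.
  have /filter_ex[N [[AKN AN] /= nB]] : free_ultra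
     (([set N | A N `<=` \bigcup_(k < K) B k N] `&` [set N | A N (w N)]) `&`
      [set N | forall k : 'I_K, ~ B k N (w N)]).
    apply: filterI; first exact: filterI.
    apply: (@filter_forall _ _ (fun k N => ~ B (nat_of_ord k) N (w N))) => k.
    exact: nwB.
  have [k kK Bk] := AKN _ AN.
  by have := nB (Ordinal kK).
apply: cvg_near_cst; exists K => // M /= KM.
rewrite (Kbig _ KM) big_mkord measure_semi_additive//.
by apply: bigsetU_measurable => i _; exact: mF.
Qed.

HB.instance Definition _ := Content_isMeasure.Build _ _ R loeb_content
  loeb_content_sigma_additive.

Definition loeb_measure := measure_extension loeb_content.

HB.instance Definition _ := Measure.on loeb_measure.

Lemma loeb_measureE (A : nat -> set V) :
  loeb_measure (internal A) = (ulim (fun N => p N (A N)))%:E.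
Proof.
rewrite /loeb_measure /measure_extension measurable_mu_extE ?loeb_contentE//.
- exact: loeb_contentE.
- exact: (imageP (@internal V)).
Qed.

Lemma loeb_measureT : loeb_measure setT = 1%E.
Proof.
rewrite -[setT]internalT loeb_measureE; congr _%:E; apply: ulimP.
by under eq_fun do rewrite fapT; exact: cvg_cst.
Qed.

HB.instance Definition _ := Measure_isProbability.Build _ _ _ loeb_measure
  loeb_measureT.

End loeb_content.

Lemma measurable_funrP d (T : measurableType d) (R : realType) (D : set T)
    (f : T -> R) : measurable D ->
  (forall c, measurable (D `&` [set x | c < f x])) -> measurable_fun D f.
Proof.
move=> mD mf; apply: (measurability (RGenOInfty.G (R:=R))).
  exact: RGenOInfty.measurableE.
move=> _ [_ [c ->] <-]; rewrite (_ : f @^-1` _ = [set x | c < f x])//.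
by apply/seteqP; split => x /=; rewrite in_itv/= andbT.
Qed.

Lemma cvg_sumr (R : realType) (T : Type) (F : set_system T) {FF : Filter F}
    (I : Type) (r : seq I) (f : I -> T -> R) (l : I -> R) :
  (forall i, f i @ F --> l i) ->
  (fun x => \sum_(i <- r) f i x) @ F --> \sum_(i <- r) l i.
Proof. by move=> fl; apply: cvg_big => [|i _//]; exact: add_continuous. Qed.

Notation loeb_type V :=
  (g_sigma_algebraType (@measurable (loeb_display V) (loeb_space V))).

Section standard_part.
Context {R : realType} {V : pointedType}.
Implicit Types (G : nat -> V -> R) (w : loeb_type V).

Lemma measurable_internal (A : nat -> set V) :
  measurable (internal A : set (loeb_type V)).
Proof. by apply: sub_sigma_algebra; exact: (imageP (@internal V)). Qed.

Definition loeb_finite G : set (loeb_type V) :=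
  \bigcup_B internal (fun N => [set v | `|G N v| <= B%:R]).

(* Meaningful on [loeb_finite G] only, where the ultralimit exists. *)
Definition stdpart G w : R := ulim (fun N => G N (w N)).

Lemma measurable_loeb_finite G : measurable (loeb_finite G).
Proof. by apply: bigcupT_measurable => B; exact: measurable_internal. Qed.

Lemma stdpart_cvg G w : loeb_finite G w ->
  (fun N => G N (w N)) @ free_ultra --> stdpart G w.
Proof. by move=> [B _ wB]; exact: (@ulim_bounded _ _ B%:R). Qed.

Lemma measurable_stdpart G : measurable_fun (loeb_finite G) (stdpart G).
Proof.
apply: measurable_funrP; first exact: measurable_loeb_finite.
(* Limits keep only weak inequalities, so a strict bound on the standard part corresponds to a bound
   on [G N] with a margin [k.+1%:R^-1] independent of [N]. *)
move=> c; rewrite (_ : _ `&` _ = loeb_finite G `&`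
    \bigcup_k internal (fun N => [set v | c + k.+1%:R^-1 < G N v])).
  apply: measurableI; first exact: measurable_loeb_finite.
  by apply: bigcupT_measurable => k; exact: measurable_internal.
apply/seteqP; split=> w [wG]; have Gw := stdpart_cvg wG; [move=> /= cw|move=> [k _ kw]];
  split => //=.
  have cw2 : 0 < stdpart G w - c by rewrite subr_gt0.
  have [k kc] : exists k : nat, k.+1%:R^-1 < stdpart G w - c.
    near \oo => k; exists k; near: k; exact: (near_infty_natSinv_lt (PosNum cw2)).
  exists k => //; move: kc; rewrite ltrBrDl => kc.
  exact: (cvgr_gt _ Gw).
apply: (@lt_le_trans _ _ (c + k.+1%:R^-1)); first by rewrite ltrDl.
rewrite /stdpart /ulim; apply: limr_ge; first by apply/cvg_ex; exists (stdpart G w).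
by apply: filterS kw => N /= /ltW.
Unshelve. all: by end_near. Qed.

End standard_part.

Record fsprob (R : realType) (V : Type) := FSProb {
  fsp_index : finType;
  fsp_weight : fsp_index -> R;
  fsp_point : fsp_index -> V;
  fsp_ge0 : forall a, 0 <= fsp_weight a;
  fsp_sum1 : \sum_a fsp_weight a = 1 }.

Section fsprob_theory.
Context {R : realType} {V : Type} (D : fsprob R V).

Definition fsp_expect (g : V -> R) : R :=
  \sum_a fsp_weight (f := D) a * g (fsp_point a).

Definition fsp_prob (A : set V) : R := fsp_expect \1_A.

Lemma fsp_expect_ge0 g : (forall v, 0 <= g v) -> 0 <= fsp_expect g.
Proof. by move=> g0; apply: sumr_ge0 => a _; rewrite mulr_ge0 ?fsp_ge0. Qed.

Lemma fsp_expectD g h : fsp_expect (fun v => g v + h v) = fsp_expect g + fsp_expect h.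
Proof. by rewrite -big_split; apply: eq_bigr => a _; rewrite mulrDr. Qed.

Lemma fsp_expectZ c g : fsp_expect (fun v => c * g v) = c * fsp_expect g.
Proof. by rewrite mulr_sumr; apply: eq_bigr => a _; rewrite mulrCA. Qed.

Lemma fsp_expect_cst c : fsp_expect (fun=> c) = c.
Proof. by rewrite /fsp_expect -mulr_suml fsp_sum1 mul1r. Qed.

Lemma fsp_expect_le g h :
  (forall a, g (fsp_point (f := D) a) <= h (fsp_point a)) -> fsp_expect g <= fsp_expect h.
Proof. by move=> gh; apply: ler_sum => a _; rewrite ler_wpM2l ?fsp_ge0. Qed.

Lemma fsp_expect_sum I (r : seq I) (g : I -> V -> R) :
  fsp_expect (fun v => \sum_(i <- r) g i v) = \sum_(i <- r) fsp_expect (g i).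
Proof.
by rewrite exchange_big/=; apply: eq_bigr => a _; rewrite mulr_sumr.
Qed.

Lemma fsp_prob_ge0 A : 0 <= fsp_prob A.
Proof. exact: fsp_expect_ge0. Qed.

Lemma fsp_probT : fsp_prob setT = 1.
Proof. by rewrite /fsp_prob indicT; exact: fsp_expect_cst. Qed.

Lemma fsp_probU A B : A `&` B = set0 -> fsp_prob (A `|` B) = fsp_prob A + fsp_prob B.
Proof.
move=> AB; rewrite -fsp_expectD; congr fsp_expect; apply/funext => v.
rewrite !indicE in_setU; have [/set_mem Av|] := boolP (v \in A); last by rewrite add0r.
rewrite (_ : v \in B = false) ?addr0//; apply/negP => /set_mem Bv.
by have : (A `&` B) v by []; rewrite AB.
Qed.

Definition fsp_faprob : faprob R V := FAProb fsp_prob_ge0 fsp_probT fsp_probU.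

End fsprob_theory.

(** The sum counts positive integers up to [z]. With the next lemma it recovers [z] within 1, which
    is the layer-cake formula for step functions. *)
Lemma sum_leqn_le (R : realType) (K : nat) (z : R) : 0 <= z ->
  \sum_(k < K) (k.+1%:R <= z)%R%:R <= z.
Proof.
move=> z0; elim: K => [|K IH]; first by rewrite big_ord0.
rewrite big_ord_recr/=; have [Kz|_] := leP K.+1%:R z; last by rewrite addr0.
apply: le_trans Kz; rewrite -natr1 lerD2r -[leRHS]mul1r -[X in _ <= _ * X%:R]card_ord.
by rewrite mulr_natr -sumr_const; apply: ler_sum => k _; rewrite lern1 leq_b1.
Qed.

Lemma sum_leqn_ge (R : realType) (K : nat) (z : R) : z <= K%:R ->
  z - 1 <= \sum_(k < K) (k.+1%:R <= z)%R%:R.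
Proof.
elim: K => [|K IH] zK; first by rewrite big_ord0; lra.
rewrite big_ord_recr/=; have [/IH|Kz] := leP z K%:R.
  by move=> /le_trans; apply; rewrite lerDl.
rewrite (eq_bigr (fun=> 1)) => [|k _]; last first.
  by rewrite (le_trans _ (ltW Kz))// ler_nat.
rewrite sumr_const card_ord.
have : 0 <= (K.+1%:R <= z)%R%:R :> R by [].
by move: zK; rewrite -natr1; lra.
Qed.

Section loeb_expectation.
Context {R : realType} {V : pointedType} (D : nat -> fsprob R V).

Definition loeb_prob : probability (loeb_type V) R :=
  loeb_measure (fun N => fsp_faprob (D N)).

Variable G : nat -> V -> R.
Hypothesis G01 : forall N v, 0 <= G N v <= 1.

Let finG w : loeb_finite G w.
Proof.
exists 1%N => //; apply: filterS filterT => N _ /=.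
by have /andP[? ?] := G01 N (w N); rewrite ger0_norm.
Qed.

Let GE : loeb_finite G = setT.
Proof. by rewrite -subTset => w _; exact: finG. Qed.

Let mG : measurable_fun setT (stdpart G).
Proof. by rewrite -GE; exact: measurable_stdpart. Qed.

Lemma stdpart01 w : 0 <= stdpart G w <= 1.
Proof.
have Gw : cvg ((fun N => G N (w N)) @ free_ultra).
  by apply/cvg_ex; exists (stdpart G w); exact: stdpart_cvg.
rewrite limr_ge//=; first by apply: limr_le => //; apply: filterS filterT => N _;
  case/andP: (G01 N (w N)).
by apply: filterS filterT => N _; case/andP: (G01 N (w N)).
Qed.

Let Ecvg : (fun N => fsp_expect (D N) (G N)) @ free_ultra -->
  ulim (fun N => fsp_expect (D N) (G N)).
Proof.
apply: (@ulim_bounded _ _ 1); apply: filterS filterT => N _ /=.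
rewrite ger0_norm; last by apply: fsp_expect_ge0 => v; case/andP: (G01 N v).
by rewrite -(fsp_expect_cst (D N) 1) fsp_expect_le// => a; case/andP: (G01 N (fsp_point a)).
Qed.

(** The standard part is bounded below by the step function [S] built on the levels [(k + 1) / K1]
    of [G]. The layers are internal sets, whose Loeb measures are limits of finite probabilities,
    and passing to the step function loses at most [K1^-1 < e]. *)
Lemma loeb_expect_ge :
  ((ulim (fun N => fsp_expect (D N) (G N)))%:E <= \int[loeb_prob]_w (stdpart G w)%:E)%E.
Proof.
apply/lee_addgt0Pr => e e0.
have [K] : exists K : nat, K.+1%:R^-1 < e.
  near \oo => k; exists k; near: k; exact: (near_infty_natSinv_lt (PosNum e0)).
set K1 := K.+1%:R => Ke.
have K10 : 0 < K1 by rewrite /K1.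
pose A (k : nat) N : set V := [set v | k.+1%:R <= K1 * G N v].
pose S w : R := \sum_(k < K.+1) K1^-1 * \1_(internal (A k) : set (loeb_type V)) w.
have SG w : S w <= stdpart G w.
  apply: (@ler_cvg_to _ free_ultra _ _
    (fun N => \sum_(k < K.+1) K1^-1 * \1_(A k N) (w N)) (fun N => G N (w N))).
  - rewrite /S; apply: cvg_sumr => k; apply: cvgMl_tmp.
    (* Along an ultrafilter the indicator is eventually constant: [w] lies in the internal set or in
       the one given by the complements. *)
    apply: cvg_near_cst; rewrite !indicE.
    have [|] := pselect (internal (A k) w) => Aw.
      by rewrite mem_set//; apply: filterS Aw => N Aw; rewrite indicE mem_set.
    rewrite memNset//; move/free_ultraNP : (Aw); apply: filterS => N nA.
    by rewrite indicE memNset.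
  - exact: stdpart_cvg.
  - apply: filterS filterT => N _; rewrite -mulr_sumr ler_pdivrMl//.
    have /andP[G0 _] := G01 N (w N).
    apply: le_trans (@sum_leqn_le _ K.+1 (K1 * G N (w N)) _); last first.
      by rewrite mulr_ge0// ltW.
    apply: ler_sum => k _; rewrite indicE.
    have [/set_mem|_] := boolP (w N \in A k N); last exact: ler0n.
    by rewrite /A/= => ->.
have SE : (\int[loeb_prob]_w (S w)%:E = (\sum_(k < K.+1) K1^-1 *
    ulim (fun N => fsp_prob (D N) (A k N)))%:E)%E.
  rewrite /S; under eq_integral do rewrite -sumEFin.
  rewrite ge0_integral_sum//; last 2 first.
  - move=> k; apply/measurable_EFinP; apply: measurable_funM => //.
    by apply: measurable_indic; exact: measurable_internal.
  - by move=> k w _; rewrite lee_fin mulr_ge0// invr_ge0 ltW.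
  rewrite -sumEFin; apply: eq_bigr => k _.
  under eq_integral do rewrite EFinM.
  rewrite ge0_integralZl//; last 2 first.
  - by apply/measurable_EFinP; apply: measurable_indic; exact: measurable_internal.
  - by rewrite lee_fin invr_ge0 ltW.
  rewrite integral_indic//; last exact: measurable_internal.
  by rewrite setIT EFinM; congr (_ * _)%E; exact: loeb_measureE.
apply: (@le_trans _ _ (\int[loeb_prob]_w (S w)%:E + e%:E)%E); last first.
  rewrite leeD2r//; apply: ge0_le_integral => //.
  - by move=> w _; rewrite lee_fin; apply: sumr_ge0 => k _; rewrite mulr_ge0// invr_ge0 ltW.
  - apply/measurable_EFinP; apply: measurable_sum => k; apply: measurable_funM => //.
    by apply: measurable_indic; exact: measurable_internal.
  - exact/measurable_EFinP.
  - by move=> w _; rewrite lee_fin.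
rewrite SE -EFinD lee_fin.
apply: (@ler_cvg_to _ free_ultra _ _ (fun N => fsp_expect (D N) (G N))
    (fun N => \sum_(k < K.+1) K1^-1 * fsp_prob (D N) (A k N) + e)).
- exact: Ecvg.
- apply: cvgD; last exact: cvg_cst.
  apply: cvg_sumr => k; apply: cvgMl_tmp.
  exact: (@fap_cvg _ _ (fun N => fsp_faprob (D N)) (A k)).
- apply: filterS filterT => N _.
  under eq_bigr do rewrite -fsp_expectZ.
  rewrite -fsp_expect_sum -[X in _ + X](fsp_expect_cst (D N)) -fsp_expectD.
  apply: fsp_expect_le => a; set v := fsp_point a.
  have /andP[_ G1] := G01 N v.
  have := @sum_leqn_ge R K.+1 (K1 * G N v).
  rewrite ler_piMr// ?(ltW K10)// => /(_ isT) H.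
  rewrite -lerBlDr; apply: (@le_trans _ _ (G N v - K1^-1)); first by rewrite lerD2l lerN2 ltW.
  rewrite -mulr_sumr ler_pdivlMl// mulrBr mulfV ?gt_eqF//.
  apply: le_trans H _; apply: ler_sum => k _; rewrite indicE.
  have [Gk|_] := leP k.+1%:R (K1 * G N v); last exact: ler0n.
  by rewrite mem_set.
Unshelve. all: by end_near. Qed.

End loeb_expectation.

Section loeb_expectation_eq.
Context {R : realType} {V : pointedType} (D : nat -> fsprob R V).

(** The one-sided bound is applied to [G] and to [1 - G]; as the two integrals add up to 1, both
    bounds are equalities. *)
Lemma loeb_expectE (G : nat -> V -> R) : (forall N v, 0 <= G N v <= 1) ->
  (\int[loeb_prob D]_w (stdpart G w)%:E = (ulim (fun N => fsp_expect (D N) (G N)))%:E)%E.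
Proof.
move=> G01.
have mst (H : nat -> V -> R) : (forall N v, 0 <= H N v <= 1) ->
    measurable_fun setT (EFin \o stdpart H : loeb_type V -> \bar R).
  move=> H01; apply/measurable_EFinP; rewrite (_ : setT = loeb_finite H).
    exact: measurable_stdpart.
  apply/esym; rewrite -subTset => w _; exists 1%N => //; apply: filterS filterT => N _ /=.
  by have /andP[? ?] := H01 N (w N); rewrite ger0_norm.
pose G' N v := 1 - G N v.
have G'01 N v : 0 <= G' N v <= 1.
  by have /andP[? ?] := G01 N v; rewrite /G'; apply/andP; split; lra.
have cv : (fun N => fsp_expect (D N) (G N)) @ free_ultra -->
    ulim (fun N => fsp_expect (D N) (G N)).
  apply: (@ulim_bounded _ _ 1); apply: filterS filterT => N _ /=.
  rewrite ger0_norm; last by apply: fsp_expect_ge0 => v; case/andP: (G01 N v).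
  by rewrite -(fsp_expect_cst (D N) 1) fsp_expect_le// => a; case/andP: (G01 N (fsp_point a)).
have st' w : stdpart G' w = 1 - stdpart G w.
  apply: ulimP; apply: cvgB; first exact: cvg_cst.
  apply: stdpart_cvg; exists 1%N => //; apply: filterS filterT => N _ /=.
  by have /andP[? ?] := G01 N (w N); rewrite ger0_norm.
have ulim' : ulim (fun N => fsp_expect (D N) (G' N)) =
    1 - ulim (fun N => fsp_expect (D N) (G N)).
  apply: ulimP; have -> : (fun N => fsp_expect (D N) (G' N)) =
      (fun N => 1 - fsp_expect (D N) (G N)).
    apply/funext => N; rewrite /G' (fsp_expectD (D N) (fun=> 1) (fun v => - G N v)).
    rewrite fsp_expect_cst; congr (_ + _).
    by under eq_fun do rewrite -mulN1r; rewrite fsp_expectZ mulN1r.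
  by apply: cvgB => //; exact: cvg_cst.
have le1 := loeb_expect_ge D G01; have le2 := loeb_expect_ge D G'01.
have sum1 : (\int[loeb_prob D]_w (stdpart G w)%:E +
    \int[loeb_prob D]_w (stdpart G' w)%:E = 1)%E.
  rewrite -ge0_integralD//; last 4 first.
  - by move=> w _; rewrite lee_fin; case/andP: (stdpart01 G01 w).
  - exact: mst.
  - by move=> w _; rewrite lee_fin; case/andP: (stdpart01 G'01 w).
  - exact: mst.
  under eq_integral do rewrite -EFinD st' addrC subrK.
  by rewrite integral_cst// mul1e; exact: probability_setT.
move: sum1 le1 le2; rewrite ulim'.
have := @integral_ge0 _ _ _ (loeb_prob D) setT (fun w => (stdpart G w)%:E).
case: (\int[loeb_prob D]_w (stdpart G w)%:E)%E => [a||] //=.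
- case: (\int[loeb_prob D]_w (stdpart G' w)%:E)%E => [b||] //= _.
  rewrite -EFinD => -[ab]; rewrite !lee_fin => h1 h2; congr _%:E.
  by apply/eqP; rewrite eq_le h1 andbT; lra.
- by case: (\int[loeb_prob D]_w (stdpart G' w)%:E)%E => [b||].
Qed.

End loeb_expectation_eq.

(** * Fejér weights of a positive definite function *)

Section cis.
Context {R : realType}.
Implicit Types s t : R.

Definition cis t : R[i] := Complex (cos t) (sin t).

Lemma cis0 : cis 0 = 1. Proof. by rewrite /cis cos0 sin0. Qed.

Lemma cisD s t : cis (s + t) = cis s * cis t.
Proof. by rewrite /cis cosD sinD; apply/eqP; rewrite eq_complex/= addrC !eqxx [sin s * _ + _]addrC eqxx. Qed.

Lemma cis_sum (I : Type) (r : seq I) (f : I -> R) :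
  cis (\sum_(i <- r) f i) = \prod_(i <- r) cis (f i).
Proof. exact: (big_morph cis cisD cis0). Qed.

Lemma cisMn t k : cis (t * k%:R) = cis t ^+ k.
Proof.
elim: k => [|k IH]; first by rewrite mulr0 cis0.
by rewrite -natr1 mulrDr mulr1 cisD IH exprSr.
Qed.

Lemma conj_cis t : (cis t)^* = cis (- t).
Proof. by rewrite /cis cosN sinN. Qed.

Lemma cis_int (k : int) : cis (pi *+ 2 * k%:~R) = 1.
Proof.
case: k => k; first by rewrite cisMn /cis cos2pi sin2pi expr1n.
by rewrite NegzE mulrNz mulrN -conj_cis cisMn /cis cos2pi sin2pi expr1n rmorph1.
Qed.

Lemma cis_neq1 t : 0 < `|t| < pi *+ 2 -> cis t != 1.
Proof.
move=> t0; rewrite eq_complex/= negb_and -cos_norm lt_eqF//.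
have -> : `|t| = (`|t| / 2) *+ 2 by rewrite -mulr_natr divfK.
have s0 : 0 < sin (`|t| / 2).
  apply: sin_gt0_pi; move: t0 => /andP[t0 tp].
  by rewrite divr_gt0//= ltr_pdivrMr// mulr_natr.
rewrite cos_mulr2n cos2sin2.
have : 0 < sin (`|t| / 2) ^+ 2 by rewrite exprn_gt0.
by lra.
Qed.

(** The sum factors over the coordinates into geometric sums, and the one at the given [j]
    vanishes. *)
Lemma sum_cis_eq0 (n M : nat) (b : 'I_n -> R) (c : R) :
  (forall j, cis (b j) ^+ M = 1) -> (exists j, cis (b j) != 1) ->
  \sum_(a : {ffun 'I_n -> 'I_M}) cis (c + \sum_j b j * (a j)%:R) = 0.
Proof.
move=> bM [j bj].
under eq_bigr do rewrite cisD cis_sum.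
rewrite -mulr_sumr -(bigA_distr_bigA (fun j a => cis (b j * (nat_of_ord a)%:R))).
rewrite (bigD1 j)//= (_ : \sum_i _ = 0) ?mul0r ?mulr0//.
apply/eqP; rewrite -(mulrI_eq0 _ (mulfI _ (x := cis (b j) - 1))) ?subr_eq0//.
under eq_bigr do rewrite cisMn.
by rewrite -subrX1 bM subrr.
Qed.

End cis.

Section positive_definite_real.
Context {R : realType} {n : nat}.

(** Take the coefficients [cis (al i)]; since [phi] is real valued, the real part of each term
    carries the cosine. *)
Lemma positive_definite_cos (phi : 'rV[R]_n -> R) :
  positive_definite (fun x => real_complex R (phi x)) ->
  forall (I : finType) (x : I -> 'rV[R]_n) (al : I -> R),
    0 <= \sum_i \sum_j cos (al i - al j) * phi (x i - x j).
Proof.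
move=> pd I x al.
have := pd #|I| (x \o enum_val) (cis \o al \o enum_val).
rewrite lecE => /andP[_] /=; congr (_ <= _).
rewrite (raddf_sum (@complex.Re R : Rcomplex R -> R)) (reindex (@enum_val I I))/=; last first.
  exact/onW_bij/enum_val_bij.
apply: eq_bigr => i _.
rewrite (raddf_sum (@complex.Re R : Rcomplex R -> R)) (reindex (@enum_val I I))/=; last first.
  exact/onW_bij/enum_val_bij.
apply: eq_bigr => j _.
by rewrite mulr0 subr0 mulrN opprK -cosB.
Qed.

End positive_definite_real.

Section indicator_sums.
Context {R : realType}.

Lemma natr_forall (I : finType) (P : pred I) :
  [forall i, P i]%:R = \prod_i (P i)%:R :> R.
Proof.
have [/forallP Pi|/forallPn[i nPi]] := boolP [forall i, P i].
  by rewrite big1// => i _; rewrite Pi.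
by rewrite (bigD1 i)//= (negbTE nPi) mul0r.
Qed.

Lemma sum_forall (n : nat) (I J : finType) (P : 'I_n -> I -> J -> bool) :
  \sum_(u : {ffun 'I_n -> I}) \sum_(v : {ffun 'I_n -> J})
     [forall j, P j (u j) (v j)]%:R =
  \prod_j \sum_b \sum_c (P j b c)%:R :> R.
Proof.
rewrite bigA_distr_bigA; apply: eq_bigr => u _.
by rewrite bigA_distr_bigA; apply: eq_bigr => v _; rewrite natr_forall.
Qed.

Lemma sum_ltn_ord (N m : nat) : (m <= N)%N ->
  \sum_(c < N) (c < m)%N%:R = m%:R :> R.
Proof.
move=> mN; under eq_bigr do rewrite mulrb.
rewrite -big_mkcond/= (big_ord_narrow mN) /=.
by rewrite sumr_const card_ord.
Qed.

Lemma sum_diff_ge0 (N k : nat) : (k <= N)%N ->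
  \sum_(b < N) \sum_(c < N) (b%:Z - c%:Z == k%:Z)%:R = N%:R - k%:R :> R.
Proof.
move=> kN; rewrite exchange_big/= -natrB// -(sum_ltn_ord (leq_subr k N)).
apply: eq_bigr => c _.
have [ck|ck] := boolP (c < N - k)%N.
  have ckN : (c + k < N)%N by lia.
  rewrite (bigD1 (Ordinal ckN))//= big1 => [|b /eqP bck].
    by rewrite addr0 (_ : _ == _)//; apply/eqP; lia.
  rewrite (_ : _ == _ = false)//; apply/eqP => bc; apply: bck; apply/val_inj => /=.
  by lia.
rewrite big1// => b _; rewrite (_ : _ == _ = false)//; apply/eqP.
have := ltn_ord b; lia.
Qed.

(** Divided by [N], this pair count is the triangular factor [1 - |k| / N] of the Fejer kernel. *)
Lemma sum_diff (N : nat) (k : int) : `|k| <= N%:Z ->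
  \sum_(b < N) \sum_(c < N) (b%:Z - c%:Z == k)%:R = N%:R - `|k|%:~R :> R.
Proof.
case: k => k kN; first by rewrite sum_diff_ge0//; lia.
rewrite NegzE normrN /= -sum_diff_ge0; last by lia.
rewrite exchange_big; apply: eq_bigr => b _; apply: eq_bigr => c _.
by congr (nat_of_bool _)%:R; apply/eqP/eqP; lia.
Qed.

End indicator_sums.

Section fejer.
Context {R : realType} {n : nat} (N : nat).
Hypothesis N0 : (0 < N)%N.
Local Notation grid := {ffun 'I_n -> 'I_(N + N)}.
Local Notation box := {ffun 'I_n -> 'I_N}.

Definition grid_angle (l : 'I_n -> int) (a : grid) : R :=
  pi / N%:R * \sum_j (l j)%:~R * ((a j)%:R - N%:R).

Let NR0 : N%:R != 0 :> R. Proof. by rewrite pnatr_eq0 -lt0n. Qed.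

Lemma grid_angleD l k a :
  grid_angle (fun j => l j + k j) a = grid_angle l a + grid_angle k a.
Proof.
rewrite /grid_angle -mulrDr -big_split/=; congr (_ * _); apply: eq_bigr => j _.
by rewrite intrD mulrDl.
Qed.

Lemma grid_angleB l k a :
  grid_angle (fun j => l j - k j) a = grid_angle l a - grid_angle k a.
Proof.
rewrite /grid_angle -mulrBr -sumrB/=; congr (_ * _); apply: eq_bigr => j _.
by rewrite intrB mulrBl.
Qed.

(** Discrete orthogonality. The grid has [N + N] points per coordinate because it is applied to a
    difference of two box indices, below [N] in absolute value, shifted by some [k] with
    [|k j| <= N]. *)
Lemma sum_cos_grid (l : 'I_n -> int) : (forall j, `|l j| < (N + N)%:Z) ->
  \sum_(a : grid) cos (grid_angle l a) = [forall j, l j == 0]%:R * ((N + N) ^ n)%:R.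
Proof.
move=> lN; have [/forallP l0|/forallPn[j lj]] := boolP [forall j, l j == 0].
  rewrite mul1r (eq_bigr (fun=> 1)) => [|a _].
    by rewrite sumr_const card_ffun !card_ord.
  by rewrite /grid_angle big1 ?mulr0 ?cos0// => j _; rewrite (eqP (l0 j)) mul0r.
rewrite mul0r.
pose b j : R := pi / N%:R * (l j)%:~R.
pose c : R := - \sum_j b j * N%:R.
transitivity (complex.Re (\sum_(a : grid) cis (c + \sum_j b j * (a j)%:R))).
  rewrite (raddf_sum (@complex.Re R : Rcomplex R -> R)); apply: eq_bigr => a _ /=.
  congr cos; rewrite /c addrC -sumrB /grid_angle mulr_sumr; apply: eq_bigr => i _.
  by rewrite /b -mulrBr mulrA.
rewrite sum_cis_eq0//.
  move=> i; rewrite -cisMn -(cis_int (l i)); congr cis.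
  by rewrite /b natrD mulr2n; field.
exists j; apply: cis_neq1; have := lN j.
rewrite /b !normrM normfV (ger0_norm (pi_ge0 _)) normr_nat -intr_norm.
move=> ljN; apply/andP; split.
  apply: mulr_gt0; first by rewrite divr_gt0 ?pi_gt0 ?ltr0n.
  by rewrite ltr0z normr_gt0.
rewrite -[pi *+ 2]mulr_natr mulrAC ltr_pdivrMr ?ltr0n// -mulrA ltr_pM2l ?pi_gt0//.
by rewrite -natrM pmulrn ltr_int; lia.
Qed.


Variables (delta : R) (phi : 'rV[R]_n -> R).
Hypotheses (delta0 : 0 < delta) (phi0 : phi 0 = 1)
  (phiN : forall x, phi (- x) = phi x)
  (pd : positive_definite (fun x => real_complex R (phi x))).

Definition lattice (k : 'I_n -> int) : 'rV[R]_n := \row_j (delta * (k j)%:~R).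

Let latticeN k : lattice (fun j => - k j) = - lattice k.
Proof. by apply/rowP => j; rewrite !mxE intrN mulrN. Qed.

Let latticeB k l : lattice (fun j => k j - l j) = lattice k - lattice l.
Proof. by apply/rowP => j; rewrite !mxE intrB mulrBr. Qed.

(** The grid dual to the lattice of mesh [delta]: the inner product with [lattice k] is
    [grid_angle k a], and the points fill a cube of half side [pi / delta]. *)
Definition fejer_point (a : grid) : 'rV[R]_n :=
  \row_j (pi / (N%:R * delta) * ((a j)%:R - N%:R)).

Lemma inner_fejer_point k a : inner (lattice k) (fejer_point a) = grid_angle k a.
Proof.
rewrite /inner /grid_angle mulr_sumr; apply: eq_bigr => j _.
by rewrite !mxE; field; rewrite NR0 gt_eqF.
Qed.

Let ind (u : box) (j : 'I_n) : int := (u j : nat)%:Z.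

(** The quadratic form of [phi] on a box of lattice points, with unimodular coefficients depending
    on [a]. It is also the discrete Fourier inverse of [phi] damped by triangular factors: the first
    view gives nonnegativity, the second the cosine sums. *)
Definition fejer_weight (a : grid) : R :=
  (((N + N) ^ n * N ^ n)%:R)^-1 * \sum_(u : box) \sum_(v : box)
    cos (grid_angle (ind u) a - grid_angle (ind v) a) *
    phi (lattice (ind u) - lattice (ind v)).

Let c0 : 0 < ((N + N) ^ n * N ^ n)%:R :> R.
Proof. by rewrite ltr0n muln_gt0 !expn_gt0 addn_gt0 N0. Qed.

Lemma fejer_weight_ge0 a : 0 <= fejer_weight a.
Proof.
rewrite mulr_ge0 ?invr_ge0 ?(ltW c0)//.
exact: (positive_definite_cos pd (fun u : box => lattice (ind u))
  (fun u => grid_angle (ind u) a)).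
Qed.

Let count (k : 'I_n -> int) : R :=
  \sum_(u : box) \sum_(v : box) [forall j, ind u j - ind v j == k j]%:R.

Let countE k : (forall j, `|k j| <= N%:Z) ->
  count k = (N ^ n)%:R * \prod_j (1 - `|k j|%:~R / N%:R).
Proof.
move=> kN.
rewrite /count (sum_forall (fun j (b c : 'I_N) => b%:Z - c%:Z == k j)).
rewrite natrX -[X in _ ^+ X]card_ord -prodr_const -big_split/=.
by apply: eq_bigr => j _; rewrite sum_diff//; field.
Qed.

(** After the product formula for cosines, orthogonality leaves the pairs with [u - v = k] or
    [v - u = k]. Evenness of [phi] gives all of them the value [phi (lattice k)], and counting them
    gives the triangular factors. *)
Lemma fejer_weightE k : (forall j, `|k j| <= N%:Z) ->
  \sum_a fejer_weight a * cos (grid_angle k a) =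
  phi (lattice k) * \prod_j (1 - `|k j|%:~R / N%:R).
Proof.
move=> kN.
have lt2N (u v : box) j : `|ind u j - ind v j| < N%:Z.
  by rewrite /ind; have := ltn_ord (u j); have := ltn_ord (v j); lia.
have SP (u v : box) : \sum_a cos (grid_angle (ind u) a - grid_angle (ind v) a) *
      cos (grid_angle k a) =
    ((N + N) ^ n)%:R / 2 * ([forall j, ind u j - ind v j == k j]%:R +
      [forall j, ind v j - ind u j == k j]%:R).
  have cc (x y : R) : cos x * cos y = (cos (x - y) + cos (x + y)) / 2.
    by rewrite cosB cosD; lra.
  under eq_bigr do rewrite cc -!grid_angleB -grid_angleD.
  rewrite -mulr_suml big_split/= !sum_cos_grid.
  - rewrite (_ : [forall j, _ == 0] = [forall j, ind u j - ind v j == k j]); last first.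
      by apply: eq_forallb => j; rewrite subr_eq0.
    rewrite (_ : [forall j, _ == 0] = [forall j, ind v j - ind u j == k j]); last first.
      by apply: eq_forallb => j; apply/eqP/eqP; lia.
    by rewrite -mulrDl -mulrA mulrC.
  - by move=> j; have := lt2N u v j; have := kN j; lia.
  - by move=> j; have := lt2N u v j; have := kN j; lia.
have phiI (u v : box) (I1 I2 : bool) :
    (I1 -> forall j, ind u j - ind v j = k j) ->
    (I2 -> forall j, ind v j - ind u j = k j) ->
    phi (lattice (ind u) - lattice (ind v)) * (I1%:R + I2%:R) =
    phi (lattice k) * (I1%:R + I2%:R).
  rewrite -latticeB; case: I1 => [/(_ isT) H _|_].
    by congr (phi (lattice _) * _); apply/funext.
  case: I2 => [/(_ isT) H|]; last by rewrite addr0 !mulr0.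
  rewrite -phiN -latticeN; congr (phi (lattice _) * _); apply/funext => j.
  by rewrite opprB.
transitivity ((((N + N) ^ n * N ^ n)%:R)^-1 * \sum_(u : box) \sum_(v : box)
    (((N + N) ^ n)%:R / 2 * phi (lattice k) *
     ([forall j, ind u j - ind v j == k j]%:R + [forall j, ind v j - ind u j == k j]%:R))).
  under eq_bigr do rewrite /fejer_weight -mulrA.
  rewrite -mulr_sumr; congr (_ * _).
  under eq_bigr do rewrite mulr_suml.
  rewrite exchange_big/=; apply: eq_bigr => u _.
  under eq_bigr do rewrite mulr_suml.
  rewrite exchange_big/=; apply: eq_bigr => v _.
  under eq_bigr do rewrite mulrAC.
  rewrite -mulr_suml SP [LHS]mulrAC -[LHS]mulrA -[RHS]mulrA phiI// => /forallP H j; exact/eqP.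
under [X in _ * X]eq_bigr => u _ do rewrite -mulr_sumr big_split/=.
rewrite -mulr_sumr big_split/= [X in _ + X]exchange_big/= -/(count k) countE//.
rewrite natrM; set P := \prod_j _.
by field; rewrite !pnatr_eq0 !expn_eq0 !negb_and addn_eq0 negb_and -lt0n N0.
Qed.

End fejer.

(** * Cosine sums and tightness *)

Section dirichlet.
Context {R : realType}.

Lemma sin_ge_mul_cos (v : R) : 0 <= v <= pi -> v * cos v <= sin v.
Proof.
move=> /andP[]; rewrite le_eqVlt => /predU1P[<- _|v0 vpi].
  by rewrite mul0r sin0.
have [c /[!in_itv]/= /andP[c0 cv]] : exists2 c, c \in `]0, v[ &
    sin v - sin 0 = cos c * (v - 0).
  apply: MVT => //; exact/continuous_subspaceT/continuous_sin.
rewrite sin0 !subr0 => ->; rewrite mulrC ler_wpM2r ?(ltW v0)// leNgt ltr_cos.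
- by rewrite -leNgt ltW.
- by rewrite in_itv/= (ltW v0).
- by rewrite in_itv/= (ltW c0) (le_trans (ltW cv)).
Qed.

(** Half angles: [sin (t / 2) = 2 sin (t / 4) cos (t / 4)] is at least
    [(t / 4) * (2 cos (t / 4) ^ 2)], which equals [(t / 4) * (1 + cos (t / 2))]. *)
Lemma sin_half_ge (t : R) : 0 <= t <= pi -> t / 4 <= sin (t / 2).
Proof.
move=> /andP[t0 tpi]; have -> : t / 2 = (t / 4) *+ 2 by rewrite [RHS]mulr2n; lra.
have c2 : 0 <= cos ((t / 4) *+ 2).
  by apply: cos_ge0_pihalf; rewrite [t / 4 *+ 2]mulr2n; have := @pi_gt0 R => ?; apply/andP; split; lra.
have c1 : 0 <= cos (t / 4).
  by apply: cos_ge0_pihalf; have := @pi_gt0 R => ?; apply/andP; split; lra.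
have s1 : t / 4 * cos (t / 4) <= sin (t / 4).
  by apply: sin_ge_mul_cos; have := @pi_gt0 R => ?; apply/andP; split; lra.
rewrite sin_mulr2n; move: c2; rewrite cos_mulr2n => c2.
have := ler_wpM2l c1 s1; rewrite mulrCA -expr2 => h.
have t4 : 0 <= t / 4 by lra.
have := mulr_ge0 t4 c2; rewrite mulrBr mulr1 mulrnAr; lra.
Qed.

(* Telescoping: 2 sin(t/2) cos(it) = sin((i+1/2)t) - sin((i-1/2)t). *)
Lemma sum_cos_le (t : R) (m : nat) : 0 < t <= pi ->
  \sum_(i < m) cos (i%:R * t) <= 2^-1 + 2 / t.
Proof.
move=> /andP[t0 tpi].
have s4 : t / 4 <= sin (t / 2) by apply: sin_half_ge; rewrite (ltW t0).
have s0 : 0 < sin (t / 2) by lra.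
have E : (2 * sin (t / 2)) * \sum_(i < m) cos (i%:R * t) =
    sin (m%:R * t - t / 2) + sin (t / 2).
  elim: m => [|m IH]; first by rewrite big_ord0 mul0r sub0r sinN addNr mulr0.
  rewrite big_ord_recr/= mulrDr IH -[m.+1%:R]natr1.
  have -> : (m%:R + 1) * t - t / 2 = m%:R * t + t / 2 by lra.
  by rewrite sinB sinD; lra.
have Ele : (2 * sin (t / 2)) * \sum_(i < m) cos (i%:R * t) <= 1 + sin (t / 2).
  by rewrite E lerD2r sin_le1.
have : (2 * sin (t / 2)) * \sum_(i < m) cos (i%:R * t) <=
    (2 * sin (t / 2)) * (2^-1 + 2 / t).
  apply: le_trans Ele _; rewrite mulrDr addrC.
  have : t / 4 * (4 / t) <= sin (t / 2) * (4 / t).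
    by rewrite ler_wpM2r// divr_ge0// ltW.
  have -> : t / 4 * (4 / t) = 1 by field; rewrite gt_eqF.
  have -> : sin (t / 2) * (4 / t) = 2 * sin (t / 2) * (2 / t) by field; rewrite gt_eqF.
  lra.
by rewrite ler_pM2l// mulr_gt0.
Qed.

End dirichlet.

Section fejer_fsprob.
Context {R : realType} {n : nat} (N : nat) (delta : R) (phi : 'rV[R]_n -> R).
Hypotheses (N0 : (0 < N)%N) (delta0 : 0 < delta) (phi0 : phi 0 = 1)
  (phiN : forall x, phi (- x) = phi x)
  (pd : positive_definite (fun x => real_complex R (phi x))).

Lemma fejer_prob : exists D : fsprob R 'rV[R]_n,
  (forall k : 'I_n -> int, (forall j, `|k j| <= N%:Z) ->
     fsp_expect D (fun v => cos (inner (lattice delta k) v)) =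
     phi (lattice delta k) * \prod_j (1 - `|k j|%:~R / N%:R)) /\
  forall a j, `|fsp_point (f := D) a ord0 j| <= pi / delta.
Proof.
have NR : 0 < N%:R :> R by rewrite ltr0n.
have sum1 : \sum_a @fejer_weight R n N delta phi a = 1.
  have k0 (j : 'I_n) : `|(fun=> 0 : int) j| <= N%:Z by rewrite normr0.
  have := fejer_weightE N0 delta0 phiN k0.
  rewrite (_ : lattice delta _ = 0) ?phi0 ?mul1r; last first.
    by apply/rowP => j; rewrite !mxE mulr0.
  rewrite [RHS]big1 => [<-|j _]; last by rewrite normr0 mul0r subr0.
  apply: eq_bigr => a _; rewrite /grid_angle big1 ?mulr0 ?cos0 ?mulr1// => j _.
  by rewrite mul0r.
exists (@FSProb R _ _ (@fejer_weight R n N delta phi) (@fejer_point R n N delta)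
  (@fejer_weight_ge0 R n N N0 delta phi pd) sum1).
split=> [k kN|a j] /=.
  rewrite -(fejer_weightE N0 delta0 phiN kN); apply: eq_bigr => a _ /=.
  by rewrite (inner_fejer_point N0 delta0).
rewrite /fejer_point mxE normrM (@ger0_norm _ (pi / _)); last first.
  by rewrite divr_ge0 ?pi_ge0// mulr_ge0// ltW.
have aN : `|(a j)%:R - N%:R| <= N%:R :> R.
  have := ltn_ord (a j); rewrite -(ltr_nat R) natrD ler_norml => h.
  have : 0 <= (a j)%:R :> R by [].
  by lra.
apply: le_trans (ler_wpM2l _ aN) _.
  by rewrite divr_ge0 ?pi_ge0// mulr_ge0// ltW.
by rewrite le_eqVlt; apply/orP; left; apply/eqP; field; rewrite !gt_eqF.
Qed.

End fejer_fsprob.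

Section tightness.
Context {R : realType} {n : nat} (phi : 'rV[R]_n -> R) (q : nat) (D : fsprob R 'rV[R]_n).
Hypothesis q0 : (0 < q)%N.
Hypothesis DE : forall k : 'I_n -> int, (forall j, `|k j| <= (q * q)%:Z) ->
  fsp_expect D (fun v => cos (inner (lattice q%:R^-1 k) v)) =
  phi (lattice q%:R^-1 k) * \prod_j (1 - `|k j|%:~R / (q * q)%:R).
Hypothesis Dpi : forall a j, `|fsp_point (f := D) a ord0 j| <= pi * q%:R.

Let qR : 0 < q%:R :> R. Proof. by rewrite ltr0n. Qed.

Lemma fsp_expect_cos_coord (j : 'I_n) (i : nat) : (i <= q * q)%N ->
  fsp_expect D (fun v => cos (i%:R * (v ord0 j / q%:R))) =
  phi ((i%:R / q%:R) *: delta_mx ord0 j) * (1 - i%:R / (q * q)%:R).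
Proof.
move=> iq; pose k (l : 'I_n) : int := if l == j then i%:Z else 0.
have kl : lattice q%:R^-1 k = (i%:R / q%:R : R) *: delta_mx ord0 j.
  apply/rowP => l; rewrite !mxE/= /k; have [_|lj] := eqVneq l j.
    by rewrite -pmulrn mulr1 mulrC.
  by rewrite mulr0z !mulr0.
have := DE (k := k); rewrite kl => H.
rewrite (bigD1 j)//= big1 ?mulr1 in H; last first.
  by move=> l lj; rewrite /k (negbTE lj) normr0 mul0r subr0.
move: H; rewrite /k eqxx (@ger0_norm _ i%:Z)// -pmulrn => <-; last first.
  by move=> l; case: (l == j); rewrite ?normr0//; lia.
congr fsp_expect; apply/funext => v; congr cos.
rewrite /inner (bigD1 j)//= big1 ?addr0 => [|l lj]; rewrite !mxE ?eqxx/=.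
  by rewrite mulr1 mulrAC mulrA.
by rewrite (negbTE lj) mulr0 mul0r.
Qed.

(* Averaging the bound on 1 - E cos(t v_j) over multiples t of 1/q up to tau
   makes the mean cosine small wherever |v_j| > B. *)
Lemma fsp_tail (j : 'I_n) (tau eta B : R) : 0 < tau -> 0 < eta <= 1 ->
  (forall t, 0 <= t <= tau -> 1 - eta / 4 <= phi (t *: delta_mx ord0 j)) ->
  4 / tau <= q%:R -> tau <= q%:R -> 4 * tau / eta <= q%:R -> 8 / tau <= B ->
  fsp_prob D [set v | B < `|v ord0 j|] <= eta.
Proof.
move=> tau0 /andP[eta0 eta1] phitau q1 q2 q3 B8.
have tq0 : 0 <= tau * q%:R by rewrite mulr_ge0 ?ltW.
pose m := Num.truncn (tau * q%:R).
have mle : m%:R <= tau * q%:R by rewrite truncn_le.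
have mgt : tau * q%:R < m%:R + 1 by rewrite natr1 truncnS_gt.
have tq4 : 4 <= tau * q%:R by rewrite mulrC -ler_pdivrMr.
have m0 : 0 < m%:R :> R by lra.
have mq : (m <= q * q)%N.
  by rewrite -(ler_nat R) (le_trans mle)// natrM ler_wpM2r// ltW.
have B0 : 0 < B by apply: lt_le_trans B8; rewrite divr_gt0.
(* Half of the loss [eta / 2] comes from [phi], the other half from the Fejer factor, where
   [i <= tau * q] and [4 * tau / eta <= q]. *)
have cosi (i : 'I_m) : 1 - eta / 2 <=
    fsp_expect D (fun v => cos (i%:R * (v ord0 j / q%:R))).
  have im : i%:R <= m%:R :> R by rewrite ler_nat ltnW.
  rewrite fsp_expect_cos_coord; last by apply: leq_trans mq; exact: ltnW.
  have iqq : i%:R / (q * q)%:R <= eta / 4 :> R.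
    rewrite ler_pdivrMr ?ltr0n ?muln_gt0 ?q0// natrM.
    apply: (le_trans im); apply: (le_trans mle).
    rewrite mulrA ler_pM2r//.
    by move: q3; rewrite ler_pdivrMr//; lra.
  have i0 : 0 <= i%:R / (q * q)%:R :> R by rewrite divr_ge0.
  have phii : 1 - eta / 4 <= phi ((i%:R / q%:R) *: delta_mx ord0 j).
    apply: phitau; rewrite divr_ge0//= ler_pdivrMr//.
    exact: le_trans mle.
  apply: (@le_trans _ _ ((1 - eta / 4) * (1 - i%:R / (q * q)%:R))).
    have : 0 <= eta / 4 * (i%:R / (q * q)%:R) :> R by rewrite mulr_ge0// ltW// divr_gt0.
    by lra.
  by rewrite ler_wpM2r//; lra.
have up : fsp_expect D (fun v => \sum_(i < m) (1 - cos (i%:R * (v ord0 j / q%:R)))) <=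
    m%:R * (eta / 2).
  rewrite fsp_expect_sum -[X in _ <= X%:R * _]card_ord mulr_natl -sumr_const.
  apply: ler_sum => i _; rewrite (fsp_expectD D (fun=> 1) (fun v => - _)).
  rewrite fsp_expect_cst; under eq_fun do rewrite -mulN1r.
  by rewrite fsp_expectZ mulN1r; have := cosi i; lra.
have lo : fsp_expect D (fun v => (m%:R / 2) * \1_[set v | B < `|v ord0 j|] v) <=
    fsp_expect D (fun v => \sum_(i < m) (1 - cos (i%:R * (v ord0 j / q%:R)))).
  apply: fsp_expect_le => a; set v := fsp_point a; rewrite indicE.
  have [Bv|nBv] := pselect (B < `|v ord0 j|); last first.
    by rewrite memNset// mulr0; apply: sumr_ge0 => i _; rewrite subr_ge0 cos_le1.
  rewrite mem_set//.
  have t0 : 0 < `|v ord0 j| / q%:R by rewrite divr_gt0// (lt_trans B0).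
  (* The bound [pi * q] on the support excludes aliasing: the angle stays in the range where cosine
     sums are controlled. *)
  have tpi : 0 < `|v ord0 j| / q%:R <= pi by rewrite t0/= ler_pdivrMr// Dpi.
  have := sum_cos_le m tpi.
  rewrite sumrB sumr_const card_ord mulr1.
  rewrite (eq_bigr (fun i : 'I_m => cos (i%:R * (v ord0 j / q%:R)))) => [|i _]; last first.
    have [v0|v0] := leP 0 (v ord0 j); first by rewrite ger0_norm.
    by rewrite ltr0_norm// mulNr mulrN cosN.
  (* This is where [8 / tau <= B] enters. Since [m > tau * q - 1] and [4 <= tau * q], the sum of
     cosines is then at most [m / 2]. *)
  have : 2 / (`|v ord0 j| / q%:R) <= tau * q%:R / 4.
    have v0 : 0 < `|v ord0 j| by exact: lt_trans Bv.
    have tx : 8 <= `|v ord0 j| * tau by rewrite -ler_pdivrMr// (le_trans B8)// ltW.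
    have -> : 2 / (`|v ord0 j| / q%:R) = 2 * q%:R / `|v ord0 j|.
      by field; rewrite !gt_eqF.
    rewrite ler_pdivrMr//; have := ler_wpM2r (ltW qR) tx; lra.
  by lra.
move: (le_trans lo up); rewrite fsp_expectZ -/(fsp_prob D _).
have -> : m%:R * (eta / 2) = m%:R / 2 * eta by rewrite mulrCA mulrC.
by rewrite ler_pM2l// divr_gt0.
Qed.

End tightness.

(** * Bochner's theorem *)

Section bochner.
Context {R : realType} {n : nat} (phi : 'rV[R]_n -> R).
Hypotheses (phi0 : phi 0 = 1) (phiN : forall x, phi (- x) = phi x)
  (phi_cont : continuous phi)
  (pd : positive_definite (fun x => real_complex R (phi x))).

(** With q = N + 1, the mesh is [1 / q] and there are [q * q] steps: the mesh tends to 0 while the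
    lattice reaches out to q, so at a fixed point the Fejer factors tend to 1. *)
Let approx (N : nat) : {D : fsprob R 'rV[R]_n |
  (forall k : 'I_n -> int, (forall j, `|k j| <= (N.+1 * N.+1)%:Z) ->
     fsp_expect D (fun v => cos (inner (lattice N.+1%:R^-1 k) v)) =
     phi (lattice N.+1%:R^-1 k) * \prod_j (1 - `|k j|%:~R / (N.+1 * N.+1)%:R)) /\
  forall a j, `|fsp_point (f := D) a ord0 j| <= pi * N.+1%:R}.
Proof.
apply: cid.
have d0 : 0 < N.+1%:R^-1 :> R by rewrite invr_gt0.
have := fejer_prob (isT : (0 < N.+1 * N.+1)%N) d0 phi0 phiN pd.
by rewrite invrK.
Qed.

Let D N := sval (approx N).

Let crd (j : 'I_n) (N : nat) (v : 'rV[R]_n) : R := v ord0 j.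

Let T := loeb_type 'rV[R]_n.

Let near_ge (c : R) : \forall N \near \oo, c <= N.+1%:R.
Proof.
near=> N; apply: (@le_trans _ _ N%:R); last by rewrite ler_nat.
by near: N; exact: nbhs_infty_ger.
Unshelve. all: by end_near. Qed.

Let tight j (eta : R) : 0 < eta <= 1 -> exists B : nat,
  free_ultra [set N | fsp_prob (D N) [set v | B%:R < `|v ord0 j|] <= eta].
Proof.
move=> /andP[eta0 eta1].
have [tau tau0 phitau] : exists2 tau : R, 0 < tau &
    forall t, 0 <= t <= tau -> 1 - eta / 4 <= phi (t *: delta_mx ord0 j).
  have : (fun t : R => phi (t *: delta_mx ord0 j)) @ (0 : R) --> phi (0 *: delta_mx ord0 j).
    apply: continuous_comp; last exact: phi_cont.
    exact: scalel_continuous.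
  rewrite scale0r phi0 => cv.
  have e4 : 1 - eta / 4 < 1 by lra.
  have [e /= e0 He] := cvgr_ge _ cv _ e4; exists (e / 2); first by rewrite divr_gt0.
  move=> t /andP[t0 te]; apply: He => /=.
  by rewrite sub0r normrN ger0_norm//; lra.
have [B B8] : exists B : nat, 8 / tau <= B%:R.
  exists (Num.truncn (8 / tau)).+1; exact/ltW/truncnS_gt.
exists B; apply: free_ultra_near.
near=> N => /=.
have [DE Dpi] := svalP (approx N).
apply: (@fsp_tail R n phi N.+1 (D N) isT DE Dpi j tau) => //.
- by rewrite eta0.
- by near: N; exact: near_ge.
- by near: N; exact: near_ge.
- by near: N; exact: near_ge.
Unshelve. all: by end_near. Qed.

Let P := loeb_prob D.

(** For every [B] the set lies in the internal set where the coordinate exceeds [B], whose measure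
    is made small by tightness. *)
Let infinite_null j : P (~` loeb_finite (crd j)) = 0%E.
Proof.
have mfin := measurable_loeb_finite (crd j).
apply/eqP; rewrite eq_le measure_ge0 andbT; apply/lee_addgt0Pr => e e0.
rewrite add0e.
pose eta := Num.min e 1.
have eta01 : 0 < eta <= 1 by rewrite /eta lt_min e0 ltr01/= ge_min lexx orbT.
have [B tB] := tight j eta01.
pose A N : set 'rV[R]_n := [set v | `|crd j N v| <= B%:R].
have AC : ~` loeb_finite (crd j) `<=` internal (fun N => ~` A N).
  by rewrite -internalC; apply: subsetC => w wA; exists B.
apply: (@le_trans _ _ (P (internal (fun N => ~` A N)))).
  apply: le_measure => //; rewrite inE; first exact: measurableC.
  exact: measurable_internal.
have -> : P (internal (fun N => ~` A N)) =
    (ulim (fun N => fsp_faprob (D N) (~` A N)))%:E by exact: loeb_measureE.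
rewrite lee_fin (@le_trans _ _ eta)//; last by rewrite /eta ge_min lexx.
apply: limr_le.
  by apply/cvg_ex; eexists; exact: (@fap_cvg _ _ (fun N => fsp_faprob (D N))).
apply: filterS tB => N; congr (_ <= _); congr fsp_prob.
by apply/seteqP; split => v /=; rewrite ltNge => /negP.
Qed.

Let X j : T -> R := stdpart (crd j) \_ (loeb_finite (crd j)).

Let mX j : measurable_fun setT (X j).
Proof.
apply/(measurable_restrictT _ (measurable_loeb_finite _)).
exact: measurable_stdpart.
Qed.

Let k (x : 'rV[R]_n) (N : nat) (j : 'I_n) : int := Num.floor (x ord0 j * N.+1%:R).

Let k_bound x N j : `|(k x N j)%:~R / N.+1%:R - x ord0 j| <= N.+1%:R^-1.
Proof.
have N0 : 0 < N.+1%:R :> R by [].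
have /andP[k1 k2] := floor_itv (x ord0 j * N.+1%:R).
rewrite -/(k x N j) intrD1 in k1 k2.
rewrite ler_norml; apply/andP; split.
  by rewrite lerBrDr addrC lerBlDr -[X in _ + X]mul1r -mulrDl ler_pdivlMr// ltW.
rewrite lerBlDr ler_pdivrMr// mulrDl mulVf ?gt_eqF//.
by rewrite (le_trans k1)// lerDr.
Qed.

Let Ninv0 : (fun N : nat => N.+1%:R^-1 : R) @ \oo --> (0 : R).
Proof. exact: cvg_harmonic. Qed.

Let k_cvg x j : (fun N => (k x N j)%:~R / N.+1%:R : R) @ \oo --> x ord0 j.
Proof.
apply/cvgrPdist_le => e e0.
have : \forall N \near \oo, N.+1%:R^-1 <= e.
  move/cvgrPdist_le : Ninv0 => /(_ e e0); apply: filterS => N.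
  by rewrite sub0r normrN ger0_norm.
apply: filterS => N; apply: le_trans; rewrite distrC; exact: k_bound.
Qed.

Let lat x N : 'rV[R]_n := lattice N.+1%:R^-1 (k x N).

Let lat_cvg x : lat x @ \oo --> x.
Proof.

apply/cvg_ballP => e e0.
have : \forall N \near \oo, forall j, ball (x ord0 j) e (lat x N ord0 j).
  apply: (@filter_forall _ _ (fun j N => ball (x ord0 j) e (lat x N ord0 j))) => j.
  have /cvg_ballP/(_ e e0) := k_cvg (x := x) (j := j).
  by apply: filterS => N; rewrite /lat /lattice mxE mulrC.
by apply: filterS => N H; split=> // i j; rewrite ord1.
Qed.

Let dens x N : R := \prod_j (1 - `|k x N j|%:~R / (N.+1 * N.+1)%:R).

Let dens_cvg x : dens x @ \oo --> (1 : R).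
Proof.
have -> : (1 : R) = \prod_(j < n) (1 - 0) by rewrite big1// => j _; rewrite subr0.
apply: cvg_big => [|j _]; first exact: mul_continuous.
apply: cvgB; first exact: cvg_cst.
have -> : (fun N => `|k x N j|%:~R / (N.+1 * N.+1)%:R : R) =
    (fun N => `|(k x N j)%:~R / N.+1%:R| * N.+1%:R^-1 : R).
  apply/funext => N; rewrite intr_norm normrM normfV normr_nat natrM invfM.
  by rewrite mulrA.
rewrite -(mulr0 `|x ord0 j|); apply: cvgM => //.
by apply: cvg_norm; exact: k_cvg.
Qed.

Let expect_cvg x : (fun N => fsp_expect (D N) (fun v => cos (inner (lat x N) v)))
  @ \oo --> phi x.
Proof.
have H : (fun N => phi (lat x N) * dens x N) @ \oo --> phi x.
  rewrite -[X in _ --> X]mulr1; apply: cvgM => //.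
  by apply: continuous_cvg => //; exact: phi_cont.
apply: cvg_trans H; apply: near_eq_cvg.
have : \forall N \near \oo, forall j, `|k x N j| <= (N.+1 * N.+1)%:Z.
  apply: (@filter_forall _ _ (fun j N => `|k x N j| <= (N.+1 * N.+1)%:Z)) => j.
  have := near_ge (`|x ord0 j| + 1); apply: filterS => N xN.
  rewrite -(ler_int R) intr_norm -pmulrn natrM.
  have -> : `|(k x N j)%:~R| = `|(k x N j)%:~R / N.+1%:R| * N.+1%:R :> R.
    by rewrite normrM normfV normr_nat divfK.
  rewrite ler_wpM2r//; apply: le_trans xN.
  have -> : (k x N j)%:~R / N.+1%:R = x ord0 j + ((k x N j)%:~R / N.+1%:R - x ord0 j).
    by rewrite addrC subrK.
  apply: le_trans (ler_normD _ _) _; rewrite lerD2l.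
  by apply: le_trans (k_bound x N j) _; rewrite invf_le1// ler1n.
apply: filterS => N kN; have [DE _] := svalP (approx N).
by rewrite /dens -DE.
Qed.

(** The factor one half brings the values into [0, 1], as the Loeb expectation formula requires. *)
Let G x N (v : 'rV[R]_n) : R := 2^-1 * (1 - cos (inner (lat x N) v)).

Let G01 x N v : 0 <= G x N v <= 1.
Proof.
rewrite /G; have := cos_le1 (inner (lat x N) v); have := cos_geN1 (inner (lat x N) v).
by move=> ? ?; apply/andP; split; lra.
Qed.

Let stdpart_G x w : (forall j, loeb_finite (crd j) w) ->
  stdpart (G x) w = 2^-1 * (1 - cos (\sum_j x ord0 j * X j w)).
Proof.
move=> wfin; apply: ulimP; apply: cvgMl_tmp; apply: cvgB; first exact: cvg_cst.
apply: continuous_cvg; first exact: continuous_cos.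
rewrite /inner; apply: cvg_sumr => j; apply: cvgM.
  apply: cvg_trans (cvg_free_ultra (k_cvg (x := x) (j := j))); apply: near_eq_cvg.
  by apply: filterS filterT => N _; rewrite /lat /lattice mxE mulrC.
rewrite /X patchT ?inE//; exact: stdpart_cvg.
Qed.

(** The form [1 - cos] has a nonnegative integrand, ready for Tonelli's theorem. *)
Theorem bochner : exists (d : measure_display) (T : measurableType d)
    (P : probability T R) (X : 'I_n -> T -> R),
  (forall j, measurable_fun setT (X j)) /\
  forall x : 'rV[R]_n,
    (\int[P]_w (1 - cos (\sum_j x ord0 j * X j w))%:E = (1 - phi x)%:E)%E.
Proof.
exists _, T, P, X; split=> [j|x]; first exact: mX.
have mcos : measurable_fun setT (fun w => 1 - cos (\sum_j x ord0 j * X j w)).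
  apply: measurable_funB => //; apply: measurableT_comp.
    by apply: continuous_measurable_fun; exact: continuous_cos.
  by apply: measurable_sum => j; exact: measurable_funM.
have E1 : (\int[P]_w (2^-1 * (1 - cos (\sum_j x ord0 j * X j w)))%:E =
    \int[P]_w (stdpart (G x) w)%:E)%E.
  apply: ae_eq_integral => //.
  - by apply/measurable_EFinP; exact: measurable_funM.
  - apply/measurable_EFinP; rewrite (_ : setT = loeb_finite (G x)).
      exact: measurable_stdpart.
    apply/esym; rewrite -subTset => w _; exists 1%N => //; apply: filterS filterT => N _ /=.
    by have /andP[? ?] := G01 x N (w N); rewrite ger0_norm.
  - have : {ae P, forall w, forall j, loeb_finite (crd j) w}.
      apply: (@filter_forall _ _ (fun j w => loeb_finite (crd j) w)) => j.
      exists (~` loeb_finite (crd j)); split=> //.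
      by apply: measurableC; exact: measurable_loeb_finite.
    by apply: filterS => w wfin _; rewrite stdpart_G.
have E2 : ulim (fun N => fsp_expect (D N) (G x N)) = 2^-1 * (1 - phi x).
  apply: ulimP; apply: cvg_free_ultra.
  have -> : (fun N => fsp_expect (D N) (G x N)) = (fun N => 2^-1 *
      (1 - fsp_expect (D N) (fun v => cos (inner (lat x N) v)))).
    apply/funext => N; rewrite /G fsp_expectZ; congr (_ * _).
    rewrite (fsp_expectD (D N) (fun=> 1) (fun v => - _)) fsp_expect_cst; congr (_ + _).
    by under eq_fun do rewrite -mulN1r; rewrite fsp_expectZ mulN1r.
  apply: cvgMl_tmp; apply: cvgB; first exact: cvg_cst.
  exact: expect_cvg.
have := loeb_expectE D (G01 x); rewrite E2 -E1.
under eq_integral do rewrite EFinM.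
rewrite ge0_integralZl//; last first.
  exact/measurable_EFinP.
rewrite EFinM => /(congr1 (mule 2%:E)).
by rewrite !muleA -!EFinM divff// mul1e mul1r.
Qed.

End bochner.

(** * Truncated logarithms from cosines *)

Section pointwise_derivatives.
Context {R : realType}.
Implicit Types (f g : R -> R) (t a b : R).

Lemma is_derive1_eq f t a b : is_derive t 1 f a -> a = b -> is_derive t 1 f b.
Proof. by move=> ? <-. Qed.

Lemma is_derive1_cst a t : is_derive t 1 (fun=> a) 0.
Proof. exact: is_derive_cst. Qed.

Lemma is_derive1_idfun t : is_derive t 1 (fun t => t) 1.
Proof. exact: is_derive_id. Qed.

Lemma is_derive1D f g t a b : is_derive t 1 f a -> is_derive t 1 g b ->
  is_derive t 1 (fun t => f t + g t) (a + b).
Proof. by move=> fa gb; exact: (is_deriveD fa gb). Qed.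

Lemma is_derive1N f t a : is_derive t 1 f a -> is_derive t 1 (fun t => - f t) (- a).
Proof. by move=> fa; exact: (is_deriveN fa). Qed.

Lemma is_derive1M f g t a b : is_derive t 1 f a -> is_derive t 1 g b ->
  is_derive t 1 (fun t => f t * g t) (a * g t + f t * b).
Proof.
move=> fa gb; apply: is_derive1_eq (is_deriveM fa gb) _.
by rewrite addrC /GRing.scale/= [g t * a]mulrC.
Qed.

Lemma is_derive1_compose f g t a b : is_derive (g t) 1 f a -> is_derive t 1 g b ->
  is_derive t 1 (fun t => f (g t)) (a * b).
Proof. by move=> fa gb; exact: (@is_derive1_comp R f g t a b). Qed.

Lemma is_derive1_continuous f t a : is_derive t 1 f a -> {for t, continuous f}.
Proof.
move=> fa; apply/differentiable_continuous/derivable1_diffP; exact: ex_derive.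
Qed.

End pointwise_derivatives.

Section explicit_integrals.
Context {R : realType}.
Notation mu := (@lebesgue_measure R).

Definition cauchy_kernel (y : R) : R := y ^+ 2 / (1 + y ^+ 2).

Lemma sqr1p_gt0 (y : R) : 0 < 1 + y ^+ 2.
Proof. by have := sqr_ge0 y; lra. Qed.

Lemma integral_exp_cos (y : R) :
  (\int[mu]_(t in `[0%R, +oo[) (expR (- t) * (1 - cos (t * y)))%:E =
   (cauchy_kernel y)%:E)%E.
Proof.
have y1 := sqr1p_gt0 y.
pose f t : R := expR (- t) * (1 - cos (t * y)).
(* An antiderivative of [f], obtained by integrating the cosine term by parts twice; it vanishes at
   infinity. *)
pose F : R -> R := fun t => - expR (- t) +
   expR (- t) * ((1 + y ^+ 2)^-1 * (cos (t * y) - y * sin (t * y))).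
have dexp (t : R) : is_derive t 1 (fun t => expR (- t)) (- expR (- t)).
  apply: (is_derive1_eq (is_derive1_compose (f := expR) (is_derive_expR (- t))
    (is_derive1N (is_derive1_idfun t)))).
  by rewrite mulrN1.
have dlin (t : R) : is_derive t 1 (fun t => t * y) y.
  apply: (is_derive1_eq (is_derive1M (is_derive1_idfun t) (is_derive1_cst y t))).
  by rewrite mulr0 addr0 mul1r.
have dcos (t : R) : is_derive t 1 (fun t => cos (t * y)) (- sin (t * y) * y).
  by apply: (is_derive1_compose (f := cos)) => //; exact: is_derive_cos.
have dsin (t : R) : is_derive t 1 (fun t => sin (t * y)) (cos (t * y) * y).
  by apply: (is_derive1_compose (f := sin)) => //; exact: is_derive_sin.
have dF (t : R) : is_derive t 1 F (f t).
  apply: (is_derive1_eq (is_derive1D (is_derive1N (dexp t)) (is_derive1M (dexp t)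
    (is_derive1M (is_derive1_cst (1 + y ^+ 2)^-1 t) (is_derive1D (dcos t)
    (is_derive1N (is_derive1M (is_derive1_cst y t) (dsin t)))))))).
  rewrite /f; field; exact: lt0r_neq0.
have cF : continuous F by move=> t; exact: is_derive1_continuous (dF t).
have -> : cauchy_kernel y = 0 - F 0.
  rewrite /F /cauchy_kernel oppr0 mul0r expR0 cos0 sin0; field; exact: lt0r_neq0.
rewrite EFinB.
apply: ge0_continuous_FTC2y.
- by move=> t _; rewrite mulr_ge0 ?expR_ge0// subr_ge0 cos_le1.
- apply: continuous_subspaceT => t.
  apply: cvgM; first exact: is_derive1_continuous (dexp t).
  apply: cvgB; first exact: cvg_cst.
  exact: is_derive1_continuous (dcos t).
- have Fle t : `|F t| <= expR (- t) * (1 + (1 + y ^+ 2)^-1 * (1 + `|y|)).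
    rewrite /F -mulrN1 -mulrDr normrM (ger0_norm (expR_ge0 _)) ler_wpM2l ?expR_ge0//.
    apply: le_trans (ler_normD _ _) _; rewrite normrN1 lerD2l normrM.
    rewrite ger0_norm ?invr_ge0 ?(ltW y1)// ler_wpM2l ?invr_ge0 ?(ltW y1)//.
    apply: le_trans (ler_normB _ _) _; rewrite normrM.
    rewrite lerD ?cos_max// -[leRHS]mulr1 ler_wpM2l ?sin_max//.
  apply/norm_cvg0P.
  apply: (@squeeze_cvgr _ _ _ _ (fun=> 0)
    (fun t => expR (- t) * (1 + (1 + y ^+ 2)^-1 * (1 + `|y|)))).
  + by apply: nearW => t; rewrite normr_ge0 Fle.
  + exact: cvg_cst.
  + rewrite -[X in _ --> X](mul0r (1 + (1 + y ^+ 2)^-1 * (1 + `|y|))).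
    apply: cvgMr_tmp; exact: cvgr_expR.
- by move=> t _; apply: ex_derive.
- by apply: cvg_at_right_filter; exact: cF.
- by move=> t _ /=; rewrite derive1E; apply: derive_val.
Qed.

End explicit_integrals.

Section truncated_log.
Context {R : realType}.
Notation mu := (@lebesgue_measure R).
Implicit Types m y z : R.

(** For [y != 0] this is [ln m + ln |y|] up to an error that vanishes as [m] grows, so that
    differences in [y] tend to differences of logarithms. *)
Definition truncated_log m y : R :=
  2^-1 * (ln (1 + (m * y) ^+ 2) - ln (1 + (y / m) ^+ 2)).

Lemma integral_truncated_log m y : 1 < m ->
  (\int[mu]_(s in `[m^-1%R, m]) (s^-1 * cauchy_kernel (y / s))%:E =
   (truncated_log m y)%:E)%E.
Proof.
move=> m1; have m0 : 0 < m by lra.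
have mV : m^-1 < m by rewrite (lt_trans _ m1)// invf_lt1.
have mV0 : 0 < m^-1 by rewrite invr_gt0.
pose F : R -> R := fun s => - 2^-1 * ln (1 + (y * s^-1) * (y * s^-1)).
have dV (s : R) : 0 < s -> is_derive s 1 (fun s => s^-1) (- (s^-1 * s^-1)).
  move=> s0; have := @is_deriveV R (fun s => s) s 1 1.
  by rewrite /GRing.scale/= mulr1 -exprVn expr2; apply; rewrite ?gt_eqF.
have dyV (s : R) : 0 < s -> is_derive s 1 (fun s => y * s^-1) (y * - (s^-1 * s^-1)).
  move=> s0; apply: (is_derive1_eq (is_derive1M (is_derive1_cst y s) (dV s s0))).
  by rewrite mul0r add0r.
have dF (s : R) : 0 < s -> is_derive s 1 F (s^-1 * cauchy_kernel (y / s)).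
  move=> s0; have q0 : 0 < 1 + (y / s) * (y / s) by rewrite -expr2 sqr1p_gt0.
  apply: (is_derive1_eq (is_derive1M (is_derive1_cst (- 2^-1) s)
    (is_derive1_compose (f := @ln R) (g := fun s => 1 + (y * s^-1) * (y * s^-1))
    (is_derive1_ln q0)
    (is_derive1D (is_derive1_cst 1 s) (is_derive1M (dyV s s0) (dyV s s0)))))).
  rewrite /cauchy_kernel; field; rewrite (gt_eqF s0)/=.
  by rewrite gt_eqF// ltr_pwDl ?exprn_gt0 ?sqr_ge0.
have -> : truncated_log m y = F m - F m^-1.
  by rewrite /truncated_log /F invrK -!expr2 [y * m]mulrC; lra.
rewrite EFinB; apply: continuous_FTC2 => //.
- apply: continuous_in_subspaceT => s; rewrite inE/= in_itv/= => /andP[s1 _].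
  have s0 : 0 < s by exact: lt_le_trans s1.
  have cV : {for s, continuous (fun s : R => s^-1)} by exact: is_derive1_continuous (dV s s0).
  have cy : {for s, continuous (fun s : R => y / s)} by exact: is_derive1_continuous (dyV s s0).
  have cy2 : {for s, continuous (fun s : R => (y / s) ^+ 2)}.
    by move=> A; exact: (cvgM cy cy).
  apply: cvgM => //; apply: cvgM => //; apply: cvgV; first by rewrite gt_eqF// sqr1p_gt0.
  by apply: cvgD => //; exact: cvg_cst.
- split.
  + move=> s; rewrite in_itv/= => /andP[s1 _].
    have s0 : 0 < s by exact: lt_trans s1.
    by have [] := dF s s0.
  + by apply: cvg_at_right_filter; exact: is_derive1_continuous (dF _ mV0).
  + by apply: cvg_at_left_filter; exact: is_derive1_continuous (dF _ m0).
- move=> s; rewrite in_itv/= => /andP[s1 _].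
  have s0 : 0 < s by exact: lt_trans s1.
  by rewrite derive1E; have [_ ->] := dF s s0.
Qed.

Lemma truncated_log_ge0 m y : 1 < m -> 0 <= truncated_log m y.
Proof.
move=> m1; have m0 : 0 < m by lra.
rewrite /truncated_log mulr_ge0// subr_ge0 ler_ln ?posrE ?sqr1p_gt0//.
rewrite lerD2l !exprMn mulrC ler_wpM2r ?sqr_ge0// ler_pXn2r ?nnegrE ?invr_ge0 ?(ltW m0)//.
by apply: le_trans (ltW m1); rewrite invf_le1 ?ltW//; lra.
Qed.

(** A bound uniform in [y] makes the mean of a truncated logarithm finite, so that it can be
    cancelled. *)
Lemma truncated_log_le m y : 1 < m -> truncated_log m y <= ln (m ^+ 2).
Proof.
move=> m1; have m0 : 0 < m by lra.
have : ln (1 + (m * y) ^+ 2) <= ln (m ^+ 2 * m ^+ 2 * (1 + (y / m) ^+ 2)).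
  rewrite ler_ln ?posrE ?mulr_gt0 ?exprn_gt0 ?sqr1p_gt0//.
  have -> : m ^+ 2 * m ^+ 2 * (1 + (y / m) ^+ 2) = (m ^+ 2) ^+ 2 + (m * y) ^+ 2.
    by field; rewrite gt_eqF.
  by rewrite lerD2r !exprn_ege1// ltW.
rewrite lnM ?posrE ?mulr_gt0 ?exprn_gt0 ?sqr1p_gt0// lnM ?posrE ?exprn_gt0//.
by rewrite /truncated_log; lra.
Qed.

(* In this form the difference is visibly monotone in [m]. *)
Lemma truncated_logB m y z : 0 < m ->
  truncated_log m z - truncated_log m y =
  2^-1 * (ln ((1 + (m * z) ^+ 2) / (1 + (m * y) ^+ 2)) -
          ln ((1 + (z / m) ^+ 2) / (1 + (y / m) ^+ 2))).
Proof.
by move=> m0; rewrite !ln_div ?posrE ?sqr1p_gt0// /truncated_log; lra.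
Qed.

(** Cross-multiplied, this is [0 <= (z ^+ 2 - y ^+ 2) * (b ^+ 2 - a ^+ 2)]. *)
Let ratio_le y z (a b : R) : 0 <= y <= z -> 0 <= a <= b ->
  ln ((1 + (a * z) ^+ 2) / (1 + (a * y) ^+ 2)) <=
  ln ((1 + (b * z) ^+ 2) / (1 + (b * y) ^+ 2)).
Proof.
move=> /andP[y0 yz] /andP[a0 ab].
rewrite ler_ln ?posrE ?divr_gt0 ?sqr1p_gt0//.
rewrite ler_pdivrMr ?sqr1p_gt0// mulrAC ler_pdivlMr ?sqr1p_gt0//.
have yz2 : 0 <= z ^+ 2 - y ^+ 2.
  by rewrite subr_ge0 ler_pXn2r ?nnegrE// (le_trans y0).
have ab2 : 0 <= b ^+ 2 - a ^+ 2.
  by rewrite subr_ge0 ler_pXn2r ?nnegrE// (le_trans a0).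
have := mulr_ge0 yz2 ab2; rewrite !exprMn; lra.
Qed.

Lemma truncated_logB_ge0 m y z : 1 < m -> 0 <= y <= z ->
  0 <= truncated_log m z - truncated_log m y.
Proof.
move=> m1 yz; rewrite truncated_logB; last by lra.
rewrite mulr_ge0// subr_ge0 [z / m]mulrC [y / m]mulrC; apply: ratio_le => //.
rewrite invr_ge0; apply/andP; split; first lra.
by apply: le_trans (ltW m1); rewrite invf_le1 ?ltW//; lra.
Qed.

Lemma truncated_logB_nd m m' y z : 1 < m -> m <= m' -> 0 <= y <= z ->
  truncated_log m z - truncated_log m y <= truncated_log m' z - truncated_log m' y.
Proof.
move=> m1 mm yz; rewrite !truncated_logB; [|lra|lra].
rewrite ler_pM2l// lerB// ?[z / _]mulrC ?[y / _]mulrC.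
  by apply: ratio_le => //; apply/andP; split; lra.
rewrite ![_^-1 * _]mulrC ![_ / m]mulrC ![_ / m']mulrC.
apply: ratio_le => //; rewrite invr_ge0; apply/andP; split; first lra.
by rewrite lef_pV2 ?posrE; lra.
Qed.

End truncated_log.

Section same_cosine_transform.
Context {R : realType} {d : measure_display} {T : measurableType d} (P : probability T R).
Notation mu := (@lebesgue_measure R).

Lemma tonelli_set (D : set R) (f : T -> R -> R) : measurable D ->
  measurable_fun setT (fun z : T * R => f z.1 z.2) ->
  (forall w t, D t -> 0 <= f w t) ->
  (\int[P]_w \int[mu]_(t in D) (f w t)%:E = \int[mu]_(t in D) \int[P]_w (f w t)%:E)%E.
Proof.
move=> mD mf f0.
pose g (z : T * R) : \bar R := (f z.1 z.2 * \1_D z.2)%:E.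
have fg w t : ((fun t => (f w t)%:E) \_ D) t = g (w, t).
  rewrite patchE /g/= indicE; case: ifPn => _; first by rewrite mulr1.
  by rewrite mulr0.
under eq_integral do rewrite integral_mkcond.
rewrite [RHS]integral_mkcond.
transitivity (\int[P]_w \int[mu]_t g (w, t))%E.
  by apply: eq_integral => w _; apply: eq_integral => t _; rewrite fg.
rewrite fubini_tonelli.
- apply: eq_integral => t _; rewrite patchE /g/= indicE.
  case: ifPn => _; first by apply: eq_integral => w _; rewrite mulr1.
  by rewrite -[RHS](integral0 P setT); apply: eq_integral => w _; rewrite mulr0.
- apply/measurable_EFinP; apply: measurable_funM => //.
  by apply: measurableT_comp => //; exact: measurable_indic.
- move=> [w t]; rewrite /g/= lee_fin indicE.
  by have [/set_mem/f0 ?|_] := boolP (t \in D); rewrite ?mulr0// mulr1.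
Qed.

Lemma measurable_integral_set (D : set R) (f : T -> R -> R) : measurable D ->
  measurable_fun setT (fun z : T * R => f z.1 z.2) ->
  (forall w t, D t -> 0 <= f w t) ->
  measurable_fun setT (fun w => \int[mu]_(t in D) (f w t)%:E)%E.
Proof.
move=> mD mf f0.
rewrite (_ : (fun w => _) = (fun w => \int[mu]_t (f w t * \1_D t)%:E)%E).
  apply: (measurable_fun_fubini_tonelli_F (m2 := mu)
    (fun z : T * R => (f z.1 z.2 * \1_D z.2)%:E)).
  - apply/measurable_EFinP; apply: measurable_funM => //.
    by apply: measurableT_comp => //; exact: measurable_indic.
  - move=> [w t]; rewrite lee_fin/= indicE.
    by have [/set_mem/f0 ?|_] := boolP (t \in D); rewrite ?mulr0// mulr1.
apply/funext => w; rewrite integral_mkcond; apply: eq_integral => t _.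
by rewrite patchE indicE; case: ifPn => _; rewrite ?mulr1// mulr0.
Qed.

Lemma measurable_cauchy_kernel d' (T' : measurableType d') (Y : T' -> R) : measurable_fun setT Y ->
  measurable_fun setT (fun w => cauchy_kernel (Y w)).
Proof.
move=> mY; apply: (measurableT_comp (f := cauchy_kernel)) => //.
apply: continuous_measurable_fun => y; rewrite /cauchy_kernel.
have c2 : {for y, continuous (fun y : R => y ^+ 2)} by exact: exprn_continuous.
apply: cvgM => //; apply: cvgV; first by rewrite gt_eqF// sqr1p_gt0.
by apply: cvgD => //; exact: cvg_cst.
Qed.

Lemma cauchy_kernel_ge0 (y : R) : 0 <= cauchy_kernel y.
Proof. by rewrite divr_ge0 ?sqr_ge0// ltW// sqr1p_gt0. Qed.

Lemma expect_cauchy_kernel (Y : T -> R) (c : R) : measurable_fun setT Y ->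
  (\int[P]_w (cauchy_kernel (Y w * c))%:E =
   \int[mu]_(t in `[0%R, +oo[) ((expR (- t))%:E * \int[P]_w (1 - cos ((t * c) * Y w))%:E))%E.
Proof.
move=> mY.
under eq_integral do rewrite -integral_exp_cos.
rewrite (tonelli_set (f := fun w t => expR (- t) * (1 - cos (t * (Y w * c)))))//.
- apply: eq_integral => t _.
  under eq_integral => w _ do rewrite EFinM [t * _]mulrCA [Y w * _]mulrC.
  rewrite ge0_integralZl//.
  + apply/measurable_EFinP; apply: measurable_funB => //.
    apply: (measurableT_comp (f := cos)).
      by apply: continuous_measurable_fun; exact: continuous_cos.
    exact: measurable_funM.
- apply: measurable_funM.
    apply: (measurableT_comp (f := expR)); first exact: measurable_expR.
    by apply: measurable_funN.
  apply: measurable_funB => //.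
  apply: (measurableT_comp (f := cos)).
    by apply: continuous_measurable_fun; exact: continuous_cos.
  apply: measurable_funM => //; apply: measurable_funM => //.
  exact: (measurableT_comp (f := Y)).
Qed.

Lemma expect_truncated_log_eq (Y Y' : T -> R) (m : R) :
  measurable_fun setT Y -> measurable_fun setT Y' ->
  (forall t : R, 0 <= t ->
    (\int[P]_w (1 - cos (t * Y w))%:E = \int[P]_w (1 - cos (t * Y' w))%:E)%E) ->
  1 < m ->
  (\int[P]_w (truncated_log m (Y w))%:E = \int[P]_w (truncated_log m (Y' w))%:E)%E.
Proof.
move=> mY mY' YY' m1.
have H (Z : T -> R) : measurable_fun setT Z ->
    (\int[P]_w (truncated_log m (Z w))%:E =
     \int[mu]_(s in `[m^-1%R, m]) ((s^-1)%:E * \int[P]_w (cauchy_kernel (Z w * s^-1))%:E))%E.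
  move=> mZ.
  under eq_integral do rewrite -integral_truncated_log//.
  have s_gt0 (s : R) : s \in `[m^-1, m]%classic -> 0 < s.
    rewrite inE/= in_itv/= => /andP[+ _]; apply: lt_le_trans.
    by rewrite invr_gt0; lra.
  have mck (s : R) : measurable_fun setT (fun w => cauchy_kernel (Z w * s)).
    by apply: measurable_cauchy_kernel; exact: measurable_funM.
  (* On the segment [s] is positive, so its inverse may be written as a real power, which is a
     measurable function on the whole line. *)
  have inv_powR (s : R) : s \in `[m^-1, m]%classic -> s^-1 = s `^ (-1).
    by move=> /s_gt0 s0; rewrite powR_inv1// ltW.
  transitivity (\int[P]_w \int[mu]_(s in `[m^-1%R, m])
      (s `^ (-1) * cauchy_kernel (Z w * s `^ (-1)))%:E)%E.
    by apply: eq_integral => w _; apply: eq_integral => s sm; rewrite inv_powR.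
  rewrite tonelli_set//.
  - apply: eq_integral => s sm.
    under eq_integral do rewrite EFinM.
    rewrite ge0_integralZl//.
    + by rewrite inv_powR.
    + exact/measurable_EFinP.
    + by move=> w _; rewrite lee_fin cauchy_kernel_ge0.
    + by rewrite lee_fin powR_ge0.
  - have mpow : measurable_fun setT (fun z : T * R => z.2 `^ (-1)).
      by apply: (measurableT_comp (f := @powR R ^~ (-1))) => //; exact: measurable_powR.
    apply: measurable_funM => //.
    apply: (measurableT_comp (f := cauchy_kernel)); first exact: measurable_cauchy_kernel.
    by apply: measurable_funM => //; exact: (measurableT_comp (f := Z)).
  - by move=> w s sm; rewrite mulr_ge0 ?cauchy_kernel_ge0// powR_ge0.
rewrite !H//; apply: eq_integral => s; rewrite inE/= in_itv/= => /andP[s1 _].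
have s0 : 0 < s by apply: lt_le_trans s1; rewrite invr_gt0; lra.
congr (_ * _)%E; rewrite !expect_cauchy_kernel//.
apply: eq_integral => t; rewrite inE/= in_itv/= andbT => t0.
by congr (_ * _)%E; apply: YY'; rewrite divr_ge0// ltW.
Qed.

End same_cosine_transform.

(** * The logarithmic ratio of two random variables *)

Section log_ratio.
Context {R : realType}.
Implicit Types w y z : R.

(* ln (z / w) when 0 <= w <= z, the only range of interest, except that the
   value at z = 0 is 0; it is the limit of the differences of truncated
   logarithms. *)
Definition log_ratio w z : \bar R :=
  if z == 0 then 0%E else if w == 0 then +oo%E else (Num.max 0 (ln (z / w)))%:E.

Lemma log_ratio_ge0 w z : (0 <= log_ratio w z)%E.
Proof.
rewrite /log_ratio; case: ifPn => // _; case: ifPn => // _.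
by rewrite lee_fin le_max lexx.
Qed.

Lemma truncated_log_norm m y : truncated_log m `|y| = truncated_log m y.
Proof. by rewrite /truncated_log !exprMn real_normK ?num_real. Qed.

Lemma truncated_log0 m : truncated_log m 0 = 0 :> R.
Proof. by rewrite /truncated_log mulr0 mul0r expr0n addr0 subrr mulr0. Qed.

Lemma cvg_truncated_logB y z : 0 <= y <= z ->
  (fun N => (truncated_log N.+2%:R z - truncated_log N.+2%:R y)%:E) @ \oo -->
  log_ratio y z.
Proof.
move=> /andP[y0 yz]; have z0 := le_trans y0 yz; rewrite /log_ratio.
case: eqP => [z00|/eqP zn0].
  have -> : y = 0 by apply: le_anti; rewrite y0 andbT -z00.
  by rewrite z00; under eq_fun do rewrite subrr; exact: cvg_cst.
have zp : 0 < z by rewrite lt0r zn0.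
case: eqP => [->|/eqP yn0].
  under eq_fun do rewrite truncated_log0 subr0.
  apply/cvgeryP/cvgryPge => A.
  (* For [m >= 1] the truncated logarithm of [z] is at least [ln m + c], which diverges with [m]. *)
  pose c := ln z - 2^-1 * ln (1 + z ^+ 2).
  near=> N.
  have m1 : 1 < N.+2%:R :> R by rewrite ltr1n.
  have m0 : 0 < N.+2%:R :> R by rewrite ltr0n.
  have lnm : A - c <= ln N.+2%:R.
    rewrite -ler_expR lnK ?posrE//.
    apply: (@le_trans _ _ N%:R); last by rewrite ler_nat ltnW// ltnW.
    by near: N; exact: nbhs_infty_ger.
  have h1 : ln N.+2%:R + ln z <= 2^-1 * ln (1 + (N.+2%:R * z) ^+ 2).
    have -> : ln N.+2%:R + ln z = 2^-1 * ln ((N.+2%:R * z) ^+ 2).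
      by rewrite lnXn ?mulr_gt0// lnM ?posrE// [X in _ = _ * X]mulr2n; lra.
    rewrite ler_pM2l// ler_ln ?posrE ?sqr1p_gt0 ?exprn_gt0 ?mulr_gt0//.
    by rewrite lerDr.
  have h2 : ln (1 + (z / N.+2%:R) ^+ 2) <= ln (1 + z ^+ 2).
    rewrite ler_ln ?posrE ?sqr1p_gt0// lerD2l ler_pXn2r ?nnegrE ?divr_ge0//.
    by rewrite ler_pdivrMr// ler_peMr// ltW.
  by rewrite /truncated_log; move: lnm; rewrite /c; lra.
have yp : 0 < y by rewrite lt0r yn0.
rewrite (@max_r _ _ 0); last by rewrite ln_ge0// ler_pdivlMr// mul1r.
apply: cvg_EFin; first exact: nearW.
rewrite /comp/=.
(* The limit is the value at 0 of a continuous expression in [m^-1], into which [eq] below turns the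
   difference of truncated logarithms. *)
have -> : ln (z / y) = 2^-1 * (ln ((0 * 0 + z * z) / (0 * 0 + y * y)) -
    ln ((1 + (z * 0) * (z * 0)) / (1 + (y * 0) * (y * 0)))).
  rewrite !mulr0 !addr0 !add0r divr1 ln1 subr0 -!expr2 -expr_div_n.
  by rewrite lnXn ?divr_gt0// [X in _ = _ * X]mulr2n; lra.
have e_cvg : (fun N => N.+2%:R^-1 : R) @ \oo --> (0 : R).
  have := @cvg_harmonic R; move/(cvg_comp _ _ (@cvg_addnr 1)).
  by under eq_fun do rewrite /= addn1.
have eq N : truncated_log N.+2%:R z - truncated_log N.+2%:R y = 2^-1 *
   (ln ((N.+2%:R^-1 * N.+2%:R^-1 + z * z) / (N.+2%:R^-1 * N.+2%:R^-1 + y * y)) -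
    ln ((1 + (z * N.+2%:R^-1) * (z * N.+2%:R^-1)) / (1 + (y * N.+2%:R^-1) * (y * N.+2%:R^-1)))).
  rewrite truncated_logB// -!expr2; congr (_ * (ln _ - _)).
  have : 0 < N.+2%:R :> R by rewrite ltr0n.
  move: (N.+2%:R) => m m0; field.
  by rewrite !gt_eqF ?sqr1p_gt0.
under eq_fun do rewrite eq.
have cln (u : nat -> R) (l : R) : 0 < l -> u @ \oo --> l -> (fun N => ln (u N)) @ \oo --> ln l.
  by move=> l0 ul; apply: continuous_cvg => //; exact: continuous_ln.
apply: cvgMl_tmp; apply: cvgB.
  apply: cln; first by rewrite mul0r !add0r divr_gt0// mulr_gt0.
  apply: cvgM.
    by apply: cvgD; [exact: cvgM|exact: cvg_cst].
  apply: cvgV; first by rewrite mul0r add0r mulf_neq0.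
  by apply: cvgD; [exact: cvgM|exact: cvg_cst].
apply: cln; first by rewrite !mulr0 !addr0 divr1.
apply: cvgM.
  by apply: cvgD; [exact: cvg_cst|apply: cvgM; apply: cvgMl_tmp].
apply: cvgV; first by rewrite !mulr0 addr0 oner_neq0.
by apply: cvgD; [exact: cvg_cst|apply: cvgM; apply: cvgMl_tmp].
Unshelve. all: by end_near. Qed.

End log_ratio.
Arguments log_ratio {R} (w z)%_ring_scope.

Section expect_log_ratio.
Context {R : realType} {d : measure_display} {T : measurableType d}.

Lemma measurable_truncated_log (Y : T -> R) (m : R) : measurable_fun setT Y ->
  measurable_fun setT (fun w => truncated_log m (Y w)).
Proof.
move=> mY; apply: measurable_funM => //; apply: measurable_funB;
  apply: (measurableT_comp (f := @ln R)); try exact: measurable_ln;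
  apply: measurable_funD => //; apply: measurable_funX; exact: measurable_funM.
Qed.

Lemma measurable_log_ratio (Y Z : T -> R) :
  measurable_fun setT Y -> measurable_fun setT Z -> (forall w, `|Y w| <= Z w) ->
  measurable_fun setT (fun w => log_ratio `|Y w| (Z w)).
Proof.
move=> mY mZ YZ.
apply: (@emeasurable_fun_cvg _ _ _ _ (fun N w =>
    (truncated_log N.+2%:R (Z w) - truncated_log N.+2%:R (Y w))%:E)).
  move=> N; apply/measurable_EFinP; apply: measurable_funB; exact: measurable_truncated_log.
move=> w _; under eq_fun do rewrite -[truncated_log _ (Y w)]truncated_log_norm.
by apply: cvg_truncated_logB; rewrite normr_ge0 YZ.
Qed.

(** The means of the truncated logarithms may diverge as the truncation is removed; only their
    differences from that of the common [Z] increase to a limit. The equality is thus proved at each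
    level, where all means are finite, and passed on by monotone convergence. *)
Lemma expect_log_ratio_eq (P : probability T R) (Y Y' Z : T -> R) :
  measurable_fun setT Y -> measurable_fun setT Y' -> measurable_fun setT Z ->
  (forall w, `|Y w| <= Z w) -> (forall w, `|Y' w| <= Z w) ->
  (forall t : R, 0 <= t ->
    (\int[P]_w (1 - cos (t * Y w))%:E = \int[P]_w (1 - cos (t * Y' w))%:E)%E) ->
  (\int[P]_w log_ratio `|Y w| (Z w) = \int[P]_w log_ratio `|Y' w| (Z w))%E.
Proof.
move=> mY mY' mZ YZ Y'Z YY'.
have m1 N : 1 < N.+2%:R :> R by rewrite ltr1n.
have lim_log (V : T -> R) : measurable_fun setT V -> (forall w, `|V w| <= Z w) ->
   ((fun N => \int[P]_w (truncated_log N.+2%:R (Z w) - truncated_log N.+2%:R (V w))%:E) @ \oo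
     --> \int[P]_w log_ratio `|V w| (Z w))%E.
  move=> mV VZ.
  have -> : (\int[P]_w log_ratio `|V w| (Z w) = \int[P]_w limn (fun N =>
      (truncated_log N.+2%:R (Z w) - truncated_log N.+2%:R (V w))%:E))%E.
    apply: eq_integral => w _; apply/esym/cvg_lim => //.
    under eq_fun do rewrite -[truncated_log _ (V w)]truncated_log_norm.
    by apply: cvg_truncated_logB; rewrite normr_ge0 VZ.
  apply: cvg_monotone_convergence => //.
  - move=> N; apply/measurable_EFinP; apply: measurable_funB; exact: measurable_truncated_log.
  - move=> N w _; rewrite lee_fin -[truncated_log _ (V w)]truncated_log_norm.
    by apply: truncated_logB_ge0 => //; rewrite normr_ge0 VZ.
  - move=> w _ N N' NN'; rewrite lee_fin -![truncated_log _ (V w)]truncated_log_norm.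
    by apply: truncated_logB_nd => //; [rewrite ler_nat|rewrite normr_ge0 VZ].
have := lim_log _ mY YZ.
have -> : (fun N => \int[P]_w (truncated_log N.+2%:R (Z w) - truncated_log N.+2%:R (Y w))%:E)%E
  = (fun N => \int[P]_w (truncated_log N.+2%:R (Z w) - truncated_log N.+2%:R (Y' w))%:E)%E.
  apply/funext => N.
  have sumV (V : T -> R) : measurable_fun setT V -> (forall w, `|V w| <= Z w) ->
     (\int[P]_w (truncated_log N.+2%:R (Z w) - truncated_log N.+2%:R (V w))%:E +
      \int[P]_w (truncated_log N.+2%:R (V w))%:E = \int[P]_w (truncated_log N.+2%:R (Z w))%:E)%E.
    move=> mV VZ; rewrite -ge0_integralD//.
    - by apply: eq_integral => w _; rewrite -EFinD subrK.
    - move=> w _; rewrite lee_fin -[truncated_log _ (V w)]truncated_log_norm.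
      by apply: truncated_logB_ge0 => //; rewrite normr_ge0 VZ.
    - by apply/measurable_EFinP; apply: measurable_funB; exact: measurable_truncated_log.
    - by move=> w _; rewrite lee_fin truncated_log_ge0.
    - by apply/measurable_EFinP; exact: measurable_truncated_log.
  have fin : (\int[P]_w (truncated_log N.+2%:R (Y w))%:E)%E \is a fin_num.
    rewrite ge0_fin_numE; last first.
      by apply: integral_ge0 => w _; rewrite lee_fin truncated_log_ge0.
    apply: (@le_lt_trans _ _ (\int[P]_w (ln (N.+2%:R ^+ 2))%:E)%E).
      apply: ge0_le_integral => //.
      - by move=> w _; rewrite lee_fin truncated_log_ge0.
      - by apply/measurable_EFinP; exact: measurable_truncated_log.
      - by move=> w _; rewrite lee_fin truncated_log_le.
    rewrite integral_cst//= probability_setT mule1; exact: ltry.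
  have := sumV _ mY YZ; rewrite -(sumV _ mY' Y'Z).
  rewrite -(expect_truncated_log_eq (P := P) mY mY' YY' (m1 N)).
  by move=> /(congr1 (fun x => x - \int[P]_w (truncated_log N.+2%:R (Y w))%:E)%E); rewrite !addeK.
by move=> /cvg_unique; apply => //; exact: lim_log.
Qed.

End expect_log_ratio.

Lemma measurable_if_lt d (T : measurableType d) (R : realType) (f g : T -> R) :
  measurable_fun setT f -> measurable_fun setT g ->
  measurable_fun setT (fun x => if f x < g x then 1 else 0 : R).
Proof. by move=> mf mg; apply: measurable_fun_ifT => //; exact: measurable_fun_ltr. Qed.

Lemma measurable_fun_norm d (T : measurableType d) (R : realType) (f : T -> R) :
  measurable_fun setT f -> measurable_fun setT (fun x => `|f x|).
Proof. by move=> mf; apply: measurableT_comp => //; exact: normr_measurable. Qed.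

(** * Bounds on the logarithmic ratio and generic directions *)

Section log_ratio_bounds.
Context {R : realType}.
Implicit Types u v w z N : R.

Lemma log_ratio_le w z z' : 0 <= w -> 0 <= z <= z' -> (log_ratio w z <= log_ratio w z')%E.
Proof.
move=> w0 /andP[z0 zz']; rewrite /log_ratio.
case: ifPn => [_|zn0]; first exact: log_ratio_ge0.
have zp : 0 < z by rewrite lt0r zn0.
rewrite (gt_eqF (lt_le_trans zp zz')).
case: ifPn => // wn0; have wp : 0 < w by rewrite lt0r wn0.
have z'p : 0 < z' by exact: lt_le_trans zp zz'.
rewrite lee_fin ge_max !le_max lexx/=; apply/orP; right.
by rewrite ler_ln ?posrE ?divr_gt0// ler_pM2r// invr_gt0.
Qed.

(** [(N + v) / w] is the product of [(N + v) / (u + v)] and [(u + v) / w], and the first factor is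
    at most [N / u] if [u <= N], at most 1 otherwise. This is the inductive step that adds one
    coordinate to a direction. *)
Lemma log_ratio_add u v w N : 0 <= u -> 0 <= v -> 0 <= w -> 0 <= N ->
  (log_ratio w (N + v) <= log_ratio u N + log_ratio w (u + v))%E.
Proof.
move=> u0 v0 w0 N0.
have [N00|Nn0] := eqVneq N 0.
  rewrite N00 add0r {2}/log_ratio eqxx add0e; apply: log_ratio_le => //.
  by rewrite v0 lerDr.
have Np : 0 < N by rewrite lt0r Nn0.
have [u00|un0] := eqVneq u 0.
  rewrite {2}/log_ratio u00 eqxx (negbTE Nn0) addye ?leey//.
  by rewrite gt_eqF// (lt_le_trans (ltNyr 0))// log_ratio_ge0.
have up : 0 < u by rewrite lt0r un0.
have Nvp : 0 < N + v by exact: ltr_wpDr.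
have uvp : 0 < u + v by exact: ltr_wpDr.
rewrite /log_ratio (negbTE Nn0) (negbTE un0) (gt_eqF Nvp) (gt_eqF uvp).
case: ifPn => // wn0; have wp : 0 < w by rewrite lt0r wn0.
rewrite -EFinD lee_fin ge_max; apply/andP; split.
  by rewrite addr_ge0// le_max lexx.
have -> : (N + v) / w = (N + v) / (u + v) * ((u + v) / w).
  by field; rewrite !gt_eqF.
rewrite lnM ?posrE ?divr_gt0// lerD//; last by rewrite le_max lexx orbT.
rewrite le_max; have [uN|Nu] := leP u N.
  apply/orP; right; rewrite ler_ln ?posrE ?divr_gt0//.
  rewrite ler_pdivrMr// mulrAC ler_pdivlMr// mulrDl mulrDr lerD2l.
  by rewrite mulrC ler_wpM2r.
by apply/orP; left; rewrite ln_le0// ler_pdivrMr// mul1r lerD2r ltW.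
Qed.

Definition dyadic_lt w z (k : nat) : R := if w < 2^-1 ^+ k * z then 1 else 0.

Lemma dyadic_lt_ge0 w z k : 0 <= dyadic_lt w z k.
Proof. by rewrite /dyadic_lt; case: ifP. Qed.

(** If n is least with [2^-1 ^+ n * z <= w], then [ln (z / w) <= n * ln 2] and every index below n
    contributes 1 to the series. The mean of a logarithm is thereby reduced to measures of sublevel
    sets. *)
Lemma log_ratio_le_dyadic w z : 0 <= w -> 0 <= z ->
  (log_ratio w z <= (ln 2)%:E * \sum_(0 <= k <oo) (dyadic_lt w z k)%:E)%E.
Proof.
move=> w0 z0.
have ln2 : 0 < ln 2 :> R by rewrite ln_gt0// ltr1n.
have sum_ge (n : nat) : (forall k, (k < n)%N -> w < 2^-1 ^+ k * z) ->
    (n%:R%:E <= \sum_(0 <= k <oo) (dyadic_lt w z k)%:E)%E.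
  move=> wz; apply: (@le_trans _ _ (\sum_(0 <= k < n) (dyadic_lt w z k)%:E)%E); last first.
    by apply: nneseries_lim_ge => k _ _; rewrite lee_fin dyadic_lt_ge0.
  rewrite big_mkord (eq_bigr (fun=> 1%:E)) => [|k _]; last by rewrite /dyadic_lt wz.
  by rewrite sumEFin sumr_const card_ord.
rewrite /log_ratio; case: ifPn => [_|zn0].
  by rewrite mule_ge0 ?lee_fin ?(ltW ln2)//; exact: (sum_ge 0%N).
have zp : 0 < z by rewrite lt0r zn0.
case: ifPn => [/eqP w00|wn0].
  rewrite (_ : (\sum_(0 <= k <oo) _)%E = +oo%E) ?gt0_muley ?lte_fin//.
  apply/eqyP => A A0.
  apply: (@le_trans _ _ (Num.truncn A).+1%:R%:E); first by rewrite lee_fin ltW// truncnS_gt.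
  by apply: sum_ge => k _; rewrite w00 mulr_gt0// exprn_gt0.
have wp : 0 < w by rewrite lt0r wn0.
have ex : exists n : nat, 2^-1 ^+ n * z <= w.
  have wz : 0 < w / z by rewrite divr_gt0.
  have : (fun n : nat => 2^-1 ^+ n : R) @ \oo --> (0 : R).
    rewrite exprn_geometric; apply: cvg_geometric.
    by rewrite ger0_norm// invf_lt1// ltr1n.
  move=> /cvgrPdist_le/(_ _ wz)[n _ /(_ n (leqnn n))/=].
  rewrite sub0r normrN ger0_norm ?exprn_ge0//.
  by rewrite ler_pdivlMr// => ?; exists n.
case: (ex_minnP ex) => n nw nmin.
apply: (@le_trans _ _ ((ln 2)%:E * n%:R%:E)%E); last first.
  rewrite lee_pmul2l ?lte_fin//; apply: sum_ge => k kn; rewrite ltNge; apply/negP => /nmin.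
  by rewrite leqNgt kn.
rewrite -EFinM lee_fin ge_max mulr_ge0 ?(ltW ln2)//=.
rewrite mulr_natr -lnXn// ler_ln ?posrE ?divr_gt0 ?exprn_gt0//.
rewrite ler_pdivrMr// mulrC -ler_pdivrMr ?exprn_gt0//.
by move: nw; rewrite exprVn mulrC.
Qed.

(** The bound is trivial for [e >= 1 / 8]. Otherwise, if [|v|] is at most a quarter of [|u| + |v|],
    then [|u + t * v|] is at least half of that sum and the set is empty; if not, the set lies in a
    ball around [- u / v] of radius at most [4 * e]. *)
Lemma measure_small_affine (u v e : R) : 0 < e ->
  (\int[@lebesgue_measure R]_(t in `[0%R, 1%R])
     (if `|u + t * v| < e * (`|u| + `|v|) then 1 else 0)%:E <= (8 * e)%:E)%E.
Proof.
move=> e0.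
have mif : measurable_fun setT
    (fun t : R => if `|u + t * v| < e * (`|u| + `|v|) then 1 else 0 : R).
  apply: measurable_if_lt => //; apply: measurableT_comp; first exact: normr_measurable.
  by apply: measurable_funD => //; exact: measurable_funM.
have le1 : (\int[@lebesgue_measure R]_(t in `[0%R, 1%R])
     (if (`|u + t * v| < e * (`|u| + `|v|))%R then 1 else 0)%:E <= 1%:E)%E.
  apply: (@le_trans _ _ (\int[@lebesgue_measure R]_(t in `[0%R, 1%R]) (cst 1%E t))%E).
    apply: ge0_le_integral => //.
    - by move=> t _; case: ifP.
    - by apply/measurable_EFinP; exact: measurable_funTS.
    - by move=> t _; rewrite lee_fin; case: ifP.
  by rewrite integral_cst//= mul1e lebesgue_measure_itv/= lte_fin ltr01 -EFinB subr0.
have [e8|e8] := leP (1 / 8) e.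
  by apply: le_trans le1 _; rewrite lee_fin; lra.
have s0 : 0 <= `|u| + `|v| by rewrite addr_ge0.
have [v4|v4] := leP `|v| ((`|u| + `|v|) / 4).
  rewrite (eq_integral (fun=> 0%E)) ?integral0 ?lee_fin; first lra.
  move=> t; rewrite inE/= in_itv/= => /andP[t0 t1].
  rewrite ifF//; apply/negbTE; rewrite -leNgt.
  have : `|t * v| <= `|v| by rewrite normrM ger0_norm// ler_piMl.
  have := lerB_normD u (t * v).
  have : e * (`|u| + `|v|) <= (1 / 8) * (`|u| + `|v|) by rewrite ler_wpM2r// ltW.
  lra.
have v0 : 0 < `|v| by apply: le_lt_trans v4; rewrite divr_ge0.
have vn0 : v != 0 by rewrite -normr_gt0.
pose r := e * (`|u| + `|v|) / `|v|.
have r4 : r <= 4 * e.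
  rewrite /r -mulrA mulrC ler_wpM2r ?(ltW e0)// ler_pdivrMr//; lra.
have r0 : 0 <= r by rewrite divr_ge0// mulr_ge0// ltW.
apply: (@le_trans _ _ (\int[@lebesgue_measure R]_(t in `[0%R, 1%R])
    (\1_(ball (- u / v) r) t)%:E)%E).
  apply: ge0_le_integral => //.
  - by move=> t _; case: ifP.
  - by apply/measurable_EFinP; exact: measurable_funTS.
  - by apply/measurable_EFinP; apply: measurable_indic; exact: measurable_ball.
  - move=> t _; case: ifPn => [ut|_]; last by rewrite lee_fin.
    rewrite indicE mem_set// /ball/= /r ltr_pdivlMr// -normrM.
    rewrite mulrBl divfK// -normrN opprB opprK addrC.
    by rewrite addrC [t * v + u]addrC.
rewrite integral_indic//; last exact: measurable_ball.
apply: (@le_trans _ _ (lebesgue_measure (ball (- u / v) r))).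
  by apply: le_measure; rewrite ?inE//; [apply: measurableI => //|]; exact: measurable_ball.
by rewrite lebesgue_measure_ball// lee_fin mulr_natl; move: r4; lra.
Qed.

End log_ratio_bounds.
Arguments dyadic_lt {R} (w z)%_ring_scope k%_nat_scope.

Section generic_direction.
Context {R : realType} {d : measure_display} {T : measurableType d} (P : probability T R).
Notation mu := (@lebesgue_measure R).

(* For fixed (U, V) the integral over t in [0, 1] is bounded by an absolute
   constant, so by Tonelli almost every t works. *)
Lemma generic_combination (U V : T -> R) :
  measurable_fun setT U -> measurable_fun setT V ->
  exists2 t : R, 0 <= t <= 1 &
    (\int[P]_w log_ratio `|U w + t * V w|%R (`|U w| + `|V w|)%R < +oo)%E.
Proof.
move=> mU mV.
pose b k w (t : R) : R := dyadic_lt `|U w + t * V w| (`|U w| + `|V w|) k.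
have mb k : measurable_fun setT (fun z : T * R => b k z.1 z.2).
  apply: measurable_if_lt.
    apply: measurable_fun_norm.
    apply: measurable_funD; first exact: (measurableT_comp (f := U)).
    by apply: measurable_funM => //; exact: (measurableT_comp (f := V)).
  apply: measurable_funM => //; apply: measurable_funD.
    by apply: measurable_fun_norm; exact: (measurableT_comp (f := U)).
  by apply: measurable_fun_norm; exact: (measurableT_comp (f := V)).
have mbt k t : measurable_fun setT (fun w => (b k w t)%:E).
  apply/measurable_EFinP; apply: measurable_if_lt.
    by apply: measurable_fun_norm; apply: measurable_funD => //; exact: measurable_funM.
  apply: measurable_funM => //; apply: measurable_funD; exact: measurable_fun_norm.
pose F k t := (\int[P]_w (b k w t)%:E)%E.
have F0 k t : (0 <= F k t)%E.
  by apply: integral_ge0 => w _; rewrite lee_fin dyadic_lt_ge0.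
have mF k : measurable_fun setT (F k).
  apply: (measurable_fun_fubini_tonelli_G (m1 := P) (fun z => (b k z.1 z.2)%:E)).
  - exact/measurable_EFinP.
  - by move=> z; rewrite lee_fin dyadic_lt_ge0.
have intF k : (\int[mu]_(t in `[0%R, 1%R]) F k t <= (8 * 2^-1 ^+ k)%:E)%E.
  rewrite /F -(@tonelli_set _ _ _ P _ (b k))//; last by move=> w t _; exact: dyadic_lt_ge0.
  apply: (@le_trans _ _ (\int[P]_w (cst (8 * 2^-1 ^+ k)%:E w))%E).
    apply: ge0_le_integral => //.
    - by move=> w _; apply: integral_ge0 => t _; rewrite lee_fin dyadic_lt_ge0.
    - by apply: measurable_integral_set => // w t _; exact: dyadic_lt_ge0.
    - by move=> w _; apply: measure_small_affine; rewrite exprn_gt0.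
  by rewrite integral_cst//= probability_setT mule1.
have sumF : (\int[mu]_(t in `[0%R, 1%R]) \sum_(0 <= k <oo) F k t < +oo)%E.
  rewrite integral_nneseries//; last by move=> k; apply: measurable_funTS; exact: mF.
  apply: (@le_lt_trans _ _ (\sum_(0 <= k <oo) (8 * 2^-1 ^+ k)%:E)%E).
    apply: lee_nneseries => k *; first by apply: integral_ge0.
    exact: intF.
  have /cvg_lim -> // : (fun n => \sum_(0 <= k < n) (8 * 2^-1 ^+ k)%:E)%E @ \oo -->
      (8 * (1 - 2^-1)^-1 : R)%:E.
    under eq_fun do rewrite sumEFin.
    apply: cvg_EFin; first exact: nearW.
    apply: (@cvg_geometric_series R 8 2^-1).
    by rewrite ger0_norm// invf_lt1// ltr1n.
  exact: ltry.
have [t t01 Ft] : exists2 t : R, 0 <= t <= 1 & (\sum_(0 <= k <oo) F k t < +oo)%E.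
  apply: contrapT => noF; move: sumF; rewrite ltNge => /negP; apply.
  rewrite (eq_integral (cst +oo%E)).
    by rewrite integral_cst//= lebesgue_measure_itv/= lte_fin ltr01 -EFinB subr0 mule1.
  move=> t; rewrite inE/= in_itv/= => t01.
  by apply/eqP; rewrite -leye_eq leNgt; apply/negP => Ft; apply: noF; exists t.
exists t => //.
have UV w : `|U w + t * V w| <= `|U w| + `|V w|.
  apply: le_trans (ler_normD _ _) _; rewrite lerD2l normrM.
  by move: t01 => /andP[t0 t1]; rewrite ger0_norm// ler_piMl.
have mUV : measurable_fun setT (fun w => log_ratio `|U w + t * V w| (`|U w| + `|V w|)).
  apply: measurable_log_ratio => //.
    by apply: measurable_funD => //; exact: measurable_funM.
  apply: measurable_funD; exact: measurable_fun_norm.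
apply: (@le_lt_trans _ _
    (\int[P]_w ((ln 2)%:E * \sum_(0 <= k <oo) (b k w t)%:E))%E).
  apply: ge0_le_integral => //.
  - by move=> w _; exact: log_ratio_ge0.
  - apply: emeasurable_funM => //.
    by apply: ge0_emeasurable_sum => // k w _ _; rewrite lee_fin dyadic_lt_ge0.
  - by move=> w _; exact: log_ratio_le_dyadic.
have ln2 : 0 <= ln 2 :> R by rewrite ln_ge0// ler1n.
rewrite ge0_integralZl//; first last.
- by move=> w _; apply: nneseries_ge0 => k _ _; rewrite lee_fin dyadic_lt_ge0.
- by apply: ge0_emeasurable_sum => // k w _ _; rewrite lee_fin dyadic_lt_ge0.
rewrite integral_nneseries//; last by move=> k w _; rewrite lee_fin dyadic_lt_ge0.
by rewrite lte_mul_pinfty// ?lee_fin.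
Qed.

End generic_direction.

(** * The spherical measure *)

Section borel_row_vectors.
Context {R : realType} {n : nat}.

Lemma measurable_borel_continuous (g : 'rV[R]_n -> R) : continuous g ->
  measurable_fun setT (g : borel_rV R n -> R).
Proof.
move=> cg; apply: measurable_funrP => // c; rewrite setTI.
apply: sub_sigma_algebra; rewrite (_ : [set x | _] = g @^-1` [set y | c < y])//.
by apply: open_comp => [x _|]; [exact: cg|exact: open_gt].
Qed.

Lemma continuous_inner (x : 'rV[R]_n) : continuous (inner x).
Proof.
move=> y; rewrite /inner; apply: (@cvg_sumr R _ (nbhs y)) => j; apply: cvgMl_tmp.
exact: coord_continuous.
Qed.

Lemma measurable_sphere : measurable (@sphere R n : set (borel_rV R n)).
Proof.
have mg : measurable_fun setT ((fun xi => inner xi xi) : borel_rV R n -> R).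
  apply: measurable_borel_continuous => y; rewrite /inner.
  apply: (@cvg_sumr R _ (nbhs y)) => j; apply: cvgM; exact: coord_continuous.
rewrite (_ : @sphere R n = setT `&` ((fun xi => inner xi xi) : borel_rV R n -> R) @^-1` [set 1]).
  by apply: mg => //; exact: measurable_set1.
by rewrite setTI.
Qed.

(** An open set is the union of the rational cubes that it contains, and each cube pulls back to a
    finite intersection of coordinate conditions. *)
Lemma measurable_to_borel d (T : measurableType d) (th : T -> 'rV[R]_n) :
  (forall j, measurable_fun setT (fun w => th w ord0 j)) ->
  measurable_fun setT (th : T -> borel_rV R n).
Proof.
move=> mth; apply: (@measurability _ _ _ (borel_rV R n) _ _ (@open 'rV[R]_n)) => //.
move=> _ [U openU <-]; rewrite setTI.
pose box (q : 'rV[rat]_n) (k : nat) : set 'rV[R]_n :=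
  [set y | forall j, `|y ord0 j - ratr (q ord0 j)| < k.+1%:R^-1].
have mbox q k : measurable (th @^-1` box q k).
  rewrite (_ : th @^-1` _ = \bigcap_(j in [set: 'I_n])
      [set w | `|th w ord0 j - ratr (q ord0 j)| < k.+1%:R^-1]); last first.
    by apply/seteqP; split => w /= H j => [_|]; exact: H.
  apply: fin_bigcap_measurable => // j _; rewrite -[X in measurable X]setTI.
  have mabs : measurable_fun setT (fun w => `|th w ord0 j - ratr (q ord0 j)|).
    by apply: measurable_fun_norm; exact: measurable_funB.
  rewrite (_ : [set w | _] = (fun w => `|th w ord0 j - ratr (q ord0 j)|) @^-1`
      `]-oo, k.+1%:R^-1[%classic); first exact: mabs.
  by apply/seteqP; split => w /=; rewrite in_itv.
pose A (i : nat) : set T :=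
  if (unpickle i : option ('rV[rat]_n * nat)) is Some (q, k) then
    if `[< box q k `<=` U >] then th @^-1` box q k else set0
  else set0.
rewrite (_ : th @^-1` U = \bigcup_i A i).
  apply: bigcupT_measurable => i; rewrite /A; case: (unpickle i) => // -[q k].
  by case: asboolP.
apply/seteqP; split => w; last first.
  move=> [i _]; rewrite /A; case: (unpickle i) => // -[q k].
  by case: asboolP => // qU; exact: qU.
move=> /= Uw; have := openU; rewrite openE => /(_ _ Uw)/nbhs_ballP[e /= e0 eU].
(* Every point of the chosen cube is within twice its half side of [th w], hence the factor 2. *)
have [k ke] : exists k : nat, k.+1%:R^-1 < e / 2.
  have e2 : 0 < e / 2 by rewrite divr_gt0.
  near \oo => k; exists k; near: k; exact: (near_infty_natSinv_lt (PosNum e2)).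
have k0 : 0 < k.+1%:R^-1 :> R by rewrite invr_gt0.
have /choice[q Hq] j : exists q : rat, `|th w ord0 j - ratr q| < k.+1%:R^-1.
  have [|q] := @rat_in_itvoo R (th w ord0 j - k.+1%:R^-1) (th w ord0 j + k.+1%:R^-1).
    by rewrite ltrD2l (lt_trans _ k0)// oppr_lt0.
  by rewrite in_itv/= => qi; exists q; rewrite ltr_distlC.
exists (pickle ((\row_j q j : 'rV[rat]_n), k)) => //; rewrite /A pickleK.
case: asboolP => [_ j|nb]; first by rewrite mxE.
exfalso; apply: nb => y yq; apply: eU; split=> // i j; rewrite ord1 /ball/=.
have := Hq j; have := yq j; rewrite mxE.
have := ler_distD (ratr (q j)) (th w ord0 j) (y ord0 j).
by rewrite [`|ratr _ - _|]distrC; move: ke; move: (k.+1%:R^-1) => r; lra.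
Unshelve. all: by end_near. Qed.

Lemma measurable_elog : measurable_fun setT (@elog R).
Proof.
apply: measurable_fun_ifT => //.
  apply: (measurable_fun_eqr (f := fun x => x) (g := fun=> 0)) => //.
apply/measurable_EFinP; apply: (measurableT_comp (f := @ln R)); first exact: measurable_ln.
exact: measurable_fun_norm.
Qed.

End borel_row_vectors.

Section generic_direction.
Context {R : realType} {d : measure_display} {T : measurableType d} (P : probability T R).

(** Induction on [n]: the combination already found for the other coordinates plays the role of U
    and the new coordinate that of V. The sum of the [|X j w|] replaces the Euclidean norm because
    it is additive in the coordinates. *)
Lemma generic_direction (n : nat) (X : 'I_n -> T -> R) :
  (forall j, measurable_fun setT (X j)) ->
  exists x : 'I_n -> R, (forall j, 0 <= x j <= 1) /\
    (\int[P]_w log_ratio `|\sum_j x j * X j w|%R (\sum_j `|X j w|)%R < +oo)%E.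
Proof.
elim: n X => [|n IH] X mX.
  exists (fun=> 0); split=> [[]//|].
  under eq_integral do rewrite !big_ord0 /log_ratio eqxx.
  by rewrite integral0.
have [x' [x'01 fin']] := IH (fun j => X (lift ord0 j)) (fun j => mX _).
pose U w := \sum_j x' j * X (lift ord0 j) w.
pose N w := \sum_j `|X (lift ord0 j) w|.
have mU : measurable_fun setT U.
  by apply: measurable_sum => j; exact: measurable_funM.
have mN : measurable_fun setT N.
  by apply: measurable_sum => j; exact: measurable_fun_norm.
have UN w : `|U w| <= N w.
  apply: le_trans (ler_norm_sum _ _ _) _; apply: ler_sum => j _.
  by rewrite normrM; have /andP[x0 x1] := x'01 j; rewrite ger0_norm// ler_piMl.
have [t t01 fint] := generic_combination P mU (mX ord0).
pose x (j : 'I_n.+1) : R := oapp x' t (unlift ord0 j).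
have xE w : \sum_j x j * X j w = U w + t * X ord0 w.
  rewrite big_ord_recl /x unlift_none /= addrC; congr (_ + _).
  by apply: eq_bigr => j _; rewrite liftK.
have NE w : \sum_j `|X j w| = N w + `|X ord0 w| by rewrite big_ord_recl addrC.
exists x; split=> [j|].
  by rewrite /x; case: unliftP => [i|] _ /=.
have tV w : `|t * X ord0 w| <= `|X ord0 w|.
  by rewrite normrM; move: t01 => /andP[t0 t1]; rewrite ger0_norm// ler_piMl.
have UtN w : `|U w + t * X ord0 w| <= N w + `|X ord0 w|.
  by apply: le_trans (ler_normD _ _) _; rewrite lerD.
have UtV w : `|U w + t * X ord0 w| <= `|U w| + `|X ord0 w|.
  by apply: le_trans (ler_normD _ _) _; rewrite lerD2l.
have mUt : measurable_fun setT (fun w => U w + t * X ord0 w).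
  by apply: measurable_funD => //; exact: measurable_funM.
under eq_integral do rewrite xE NE.
apply: (@le_lt_trans _ _ (\int[P]_w (log_ratio `|U w|%R (N w) +
    log_ratio `|U w + t * X ord0 w|%R (`|U w| + `|X ord0 w|)%R))%E).
  apply: ge0_le_integral => //.
  - by move=> w _; exact: log_ratio_ge0.
  - apply: measurable_log_ratio => //.
    by apply: measurable_funD => //; exact: measurable_fun_norm.
  - apply: emeasurable_funD; first exact: measurable_log_ratio.
    apply: measurable_log_ratio => //.
    by apply: measurable_funD; exact: measurable_fun_norm.
  - by move=> w _; apply: log_ratio_add => //; exact: le_trans (UN w).
rewrite ge0_integralD//.
- by rewrite lte_add_pinfty.
- by move=> w _; exact: log_ratio_ge0.
- exact: measurable_log_ratio.
- by move=> w _; exact: log_ratio_ge0.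
- apply: measurable_log_ratio => //.
  by apply: measurable_funD; exact: measurable_fun_norm.
Qed.

End generic_direction.

Section log_ratio_scale.
Context {R : realType}.
Implicit Types c w z : R.

Lemma log_ratio_scale_le c w z : 0 < c <= 1 -> 0 <= w -> 0 <= z ->
  (log_ratio (c * w) z <= log_ratio w z + (- ln c)%:E)%E.
Proof.
move=> /andP[c0 c1] w0 z0.
have lnc : 0 <= - ln c by rewrite oppr_ge0 ln_le0.
rewrite /log_ratio; case: ifPn => [_|zn0]; first by rewrite add0e lee_fin.
rewrite mulf_eq0 (gt_eqF c0)/=; case: ifPn => [_|wn0]; first by rewrite addye.
have zp : 0 < z by rewrite lt0r zn0.
have wp : 0 < w by rewrite lt0r wn0.
rewrite -EFinD lee_fin ge_max; apply/andP; split.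
  by rewrite addr_ge0// le_max lexx.
rewrite invfM mulrCA [ln (c^-1 * _)]lnM ?posrE ?invr_gt0 ?divr_gt0// lnV ?posrE//.
by rewrite [leLHS]addrC lerD2r le_max lexx orbT.
Qed.

(** For [w <= z] the maximum with 0 inside [log_ratio] is inactive, which makes the identity exact.
    The last factor reflects the value 0 at [z = 0]; its mean becomes the probability of a non-zero
    vector. *)
Lemma log_ratio_scale c w z : 0 < c <= 1 -> 0 <= w <= z ->
  log_ratio (c * w) z = (log_ratio w z + (- ln c * (z != 0)%R%:R)%:E)%E.
Proof.
move=> /andP[c0 c1] /andP[w0 wz].
have lnc : 0 <= - ln c by rewrite oppr_ge0 ln_le0.
rewrite /log_ratio; case: ifPn => [_|zn0]; first by rewrite add0e mulr0.
rewrite mulr1 mulf_eq0 (gt_eqF c0)/=; case: ifPn => [_|wn0]; first by rewrite addye.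
have zp : 0 < z by rewrite lt0r zn0 (le_trans w0).
have wp : 0 < w by rewrite lt0r wn0.
have lnzw : 0 <= ln (z / w) by rewrite ln_ge0// ler_pdivlMr// mul1r.
rewrite -EFinD invfM mulrCA [ln (c^-1 * _)]lnM ?posrE ?invr_gt0 ?divr_gt0// lnV ?posrE//.
by rewrite !max_r// ?addr_ge0// addrC.
Qed.

Lemma log_ratio_elog w z : z != 0 -> `|w| <= z ->
  log_ratio `|w| z = (- elog (w / z))%E.
Proof.
move=> zn0 wz; rewrite /log_ratio (negbTE zn0) normr_eq0 /elog mulf_eq0 invr_eq0.
rewrite (negbTE zn0) orbF; case: ifPn => // wn0.
have zp : 0 < z by rewrite lt0r zn0 (le_trans _ wz).
have wp : 0 < `|w| by rewrite normr_gt0.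
rewrite max_r; last by rewrite ln_ge0// ler_pdivlMr// mul1r.
by rewrite normrM normfV (gtr0_norm zp) !ln_div ?posrE// -EFinN opprB.
Qed.

End log_ratio_scale.

(** * From a random vector to its spherical measure *)

Section embedding.
Context {R : realType} {n : nat} {d : measure_display} {T : measurableType d}.
Variables (P : probability T R) (X : 'I_n -> T -> R) (nu : 'rV[R]_n -> R).
Hypothesis mX : forall j, measurable_fun setT (X j).
Hypothesis nuZ : forall (c : R) x, 0 < c -> nu (c *: x) = c * nu x.
Hypothesis nu0 : nu 0 = 0.
Hypothesis nu_gt0 : forall x, x != 0 -> 0 < nu x.

Let Y (x : 'rV[R]_n) w : R := \sum_j x ord0 j * X j w.
Let Z w : R := Num.sqrt (\sum_j X j w ^+ 2).

Hypothesis Ynu : forall x y, nu x = nu y -> forall t : R, 0 <= t ->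
  (\int[P]_w (1 - cos (t * Y x w))%:E = \int[P]_w (1 - cos (t * Y y w))%:E)%E.
Hypothesis Z_nontrivial : P [set w | Z w != 0] != 0%E.

Let l1 (x : 'rV[R]_n) : R := \sum_j `|x ord0 j|.

Let mY x : measurable_fun setT (Y x).
Proof. by apply: measurable_sum => j; exact: measurable_funM. Qed.

Let mZ : measurable_fun setT Z.
Proof.
apply: (measurableT_comp (f := @Num.sqrt R)).
  by apply: continuous_measurable_fun; exact: sqrt_continuous.
by apply: measurable_sum => j; exact: measurable_funX.
Qed.

Let indD w : (\1_[set w | Z w != 0] w : R) = (Z w != 0)%R%:R.
Proof.
rewrite indicE; congr (nat_of_bool _)%:R.
by apply/idP/idP => [/set_mem//|zn]; rewrite mem_set.
Qed.

Let D : set T := [set w | Z w != 0].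

Let mD : measurable D.
Proof.
rewrite (_ : D = setT `&` Z @^-1` (~` [set 0])).
  by apply: mZ => //; apply: measurableC; exact: measurable_set1.
by rewrite setTI; apply/seteqP; split => w /= /eqP.
Qed.

Let rho : R := fine (P D).

Let PD : P D = rho%:E.
Proof. by rewrite fineK// fin_num_measure. Qed.

Let rho0 : 0 < rho.
Proof. by rewrite -lte_fin -PD lt0e Z_nontrivial measure_ge0. Qed.

Let XZ j w : `|X j w| <= Z w.
Proof.
rewrite -sqrtr_sqr ler_wsqrtr// (bigD1 j)//= lerDl.
by apply: sumr_ge0 => i _; exact: sqr_ge0.
Qed.

Let Z0 w : 0 <= Z w.
Proof. exact: sqrtr_ge0. Qed.

Let ZX w : Z w <= \sum_j `|X j w|.
Proof.
have S0 : 0 <= \sum_j `|X j w| by apply: sumr_ge0.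
rewrite -[leRHS](ger0_norm S0) -sqrtr_sqr ler_wsqrtr// expr2 mulr_suml.
apply: ler_sum => j _; rewrite -real_normK ?num_real// expr2 ler_wpM2l//.
by rewrite (bigD1 j)//= lerDl; apply: sumr_ge0.
Qed.

Let Yle x w : l1 x <= 1 -> `|Y x w| <= Z w.
Proof.
move=> x1; apply: le_trans (ler_norm_sum _ _ _) _.
apply: (@le_trans _ _ (\sum_j `|x ord0 j| * Z w)).
  by apply: ler_sum => j _; rewrite normrM ler_wpM2l.
by rewrite -mulr_suml ler_piMl.
Qed.

Let Lam x : \bar R := (\int[P]_w log_ratio `|Y x w|%R (Z w))%E.

Let Lam_ge0 x : (0 <= Lam x)%E.
Proof. by apply: integral_ge0 => w _; exact: log_ratio_ge0. Qed.

Let Lam_inv x y : l1 x <= 1 -> l1 y <= 1 -> nu x = nu y -> Lam x = Lam y.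
Proof.
move=> x1 y1 xy; apply: expect_log_ratio_eq => //.
- by move=> w; exact: Yle.
- by move=> w; exact: Yle.
- exact: Ynu.
Qed.

Let YZ c x w : Y (c *: x) w = c * Y x w.
Proof. by rewrite /Y mulr_sumr; apply: eq_bigr => j _; rewrite !mxE mulrA. Qed.

Let l1Z c x : 0 <= c -> l1 (c *: x) = c * l1 x.
Proof.
move=> c0; rewrite /l1 mulr_sumr; apply: eq_bigr => j _.
by rewrite !mxE normrM ger0_norm.
Qed.

Let Lam_scale c x : l1 x <= 1 -> 0 < c <= 1 -> Lam (c *: x) = (Lam x + (- ln c * rho)%:E)%E.
Proof.
move=> x1 c01; have /andP[c0 c1] := c01.
have lnc : 0 <= - ln c by rewrite oppr_ge0 ln_le0.
have -> : (- ln c * rho)%:E = (\int[P]_w (- ln c * (Z w != 0)%R%:R)%:E)%E.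
  under eq_integral do rewrite EFinM.
  under eq_integral do rewrite -indD.
  rewrite ge0_integralZl//.
  - by rewrite integral_indic// setIT EFinM -PD.
  - by apply/measurable_EFinP; exact: measurable_indic.
rewrite -ge0_integralD//.
- apply: eq_integral => w _; rewrite YZ normrM (gtr0_norm c0) log_ratio_scale//.
  by rewrite normr_ge0 Yle.
- by move=> w _; exact: log_ratio_ge0.
- by apply: measurable_log_ratio => // w; exact: Yle.
- by move=> w _; rewrite lee_fin mulr_ge0.
- apply/measurable_EFinP; apply: measurable_funM => //.
  under eq_fun do rewrite -indD.
  exact: measurable_indic.
Qed.

Let Lam_fin : exists x, [/\ x != 0, l1 x <= 1 & (Lam x < +oo)%E].
Proof.
have [x0 [x01 finx0]] := generic_direction P mX.
(* The entries of [x0] lie in [0, 1], so this factor brings their sum below 1; it is positive for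
   every [n]. *)
pose c : R := n.+1%:R^-1.
have c01 : 0 < c <= 1 by rewrite invr_gt0 ltr0n invf_le1// ler1n.
have /andP[c0 c1] := c01.
pose x : 'rV[R]_n := \row_j (c * x0 j).
have Yx w : Y x w = c * \sum_j x0 j * X j w.
  by rewrite /Y mulr_sumr; apply: eq_bigr => j _; rewrite mxE mulrA.
have lx : l1 x <= 1.
  apply: (@le_trans _ _ (\sum_(j < n) c)).
    apply: ler_sum => j _; rewrite mxE normrM (gtr0_norm c0) ler_piMr ?(ltW c0)//.
    by have /andP[? ?] := x01 j; rewrite ger0_norm.
  by rewrite sumr_const card_ord -mulr_natl ler_pdivrMr// mul1r ler_nat.
have finx : (Lam x < +oo)%E.
  have mL0 : measurable_fun setT (fun w => log_ratio `|\sum_j x0 j * X j w| (\sum_j `|X j w|)).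
    apply: measurable_log_ratio.
    - by apply: measurable_sum => j; exact: measurable_funM.
    - by apply: measurable_sum => j; exact: measurable_fun_norm.
    - move=> w; apply: le_trans (ler_norm_sum _ _ _) _; apply: ler_sum => j _.
      by rewrite normrM; have /andP[? ?] := x01 j; rewrite ger0_norm// ler_piMl.
  apply: (@le_lt_trans _ _ (\int[P]_w (log_ratio `|\sum_j x0 j * X j w|%R
      (\sum_j `|X j w|)%R + (- ln c)%:E))%E).
    apply: ge0_le_integral => //.
    - by move=> w _; exact: log_ratio_ge0.
    - by apply: measurable_log_ratio => // w; exact: Yle.
    - exact: emeasurable_funD.
    - move=> w _; rewrite Yx normrM (gtr0_norm c0).
      apply: (@le_trans _ _ (log_ratio (c * `|\sum_j x0 j * X j w|) (\sum_j `|X j w|))).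
        by apply: log_ratio_le; rewrite ?mulr_ge0 ?(ltW c0)// Z0 ZX.
      apply: log_ratio_scale_le => //; exact: sumr_ge0.
  rewrite ge0_integralD//.
  - by rewrite integral_cst//= probability_setT mule1 lte_add_pinfty// ltry.
  - by move=> w _; exact: log_ratio_ge0.
  - by move=> w _; rewrite lee_fin oppr_ge0 ln_le0.
(* At the zero vector the ratio is [+oo] on [D], which has positive probability, so a finite mean
   forces [x != 0]. *)
exists x; split=> //; apply/eqP => x00; move: finx; rewrite ltNge => /negP; apply.
apply: (@le_trans _ _ (\int[P]_(w in D) (cst +oo%E w))%E).
  by rewrite integral_cst// [X in (_ * X)%E](_ : _ = rho%:E) ?gt0_mulye ?lte_fin.
rewrite integral_mkcond; apply: ge0_le_integral => //.
- by move=> w _; apply: erestrict_ge0 => *; rewrite leey.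
- by apply/(measurable_restrictT _ mD); exact: measurable_cst.
- by apply: measurable_log_ratio => // w; exact: Yle.
- move=> w _; rewrite patchE; case: ifPn => [/set_mem Dw|_]; last exact: log_ratio_ge0.
  rewrite x00 /Y big1 => [|j _]; last by rewrite mxE mul0r.
  by rewrite /log_ratio normr0 (negbTE Dw) eqxx.
Qed.

Let Lam_log : exists A : R, forall x, x != 0 -> l1 x <= 1 ->
  Lam x = (A - rho * ln (nu x))%:E.
Proof.
have [y [yn0 y1 yfin]] := Lam_fin.
have yE : Lam y = (fine (Lam y))%:E by rewrite fineK// ge0_fin_numE.
exists (fine (Lam y) + rho * ln (nu y)) => x xn0 x1.
have nx := nu_gt0 xn0; have ny := nu_gt0 yn0.
have [xy|/ltW yx] := leP (nu x) (nu y).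
  pose c := nu x / nu y.
  have c01 : 0 < c <= 1 by rewrite divr_gt0//= ler_pdivrMr// mul1r.
  have /andP[c0 c1] := c01.
  have -> : Lam x = Lam (c *: y).
    apply: Lam_inv => //; last by rewrite nuZ// divfK// gt_eqF.
    by rewrite l1Z ?(ltW c0)//; apply: mulr_ile1; rewrite ?(ltW c0)//; apply: sumr_ge0.
  rewrite Lam_scale// yE -EFinD /c ln_div ?posrE//; congr _%:E; lra.
(* Here [x] is the vector to shrink, and the finiteness of [Lam x] is read off from that of
   [Lam (c *: x)]. *)
pose c := nu y / nu x.
have c01 : 0 < c <= 1 by rewrite divr_gt0//= ler_pdivrMr// mul1r.
have /andP[c0 c1] := c01.
have : Lam (c *: x) = Lam y.
  apply: Lam_inv => //; last by rewrite nuZ// divfK// gt_eqF.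
  by rewrite l1Z ?(ltW c0)//; apply: mulr_ile1; rewrite ?(ltW c0)//; apply: sumr_ge0.
rewrite Lam_scale// yE; have := Lam_ge0 x; case: (Lam x) => [a||]//= _.
by rewrite -EFinD => -[]; rewrite /c ln_div ?posrE// => aE; congr _%:E; lra.
Qed.

(** Where [Z w = 0], division by zero yields the zero vector, which is off the sphere; so the
    preimage of the sphere is exactly [D]. *)
Let th w : 'rV[R]_n := \row_j (X j w / Z w).

Let mth : measurable_fun setT (th : T -> borel_rV R n).
Proof.
apply: measurable_to_borel => j; under eq_fun do rewrite mxE.
have -> : (fun w => X j w / Z w) = (fun w => X j w * Z w `^ (-1)).
  by apply/funext => w; rewrite powR_inv1.
apply: measurable_funM => //.
by apply: (measurableT_comp (f := @powR R ^~ (-1))) => //; exact: measurable_powR.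
Qed.

Let inner_th x w : inner x (th w) = Y x w / Z w.
Proof. by rewrite /inner /Y mulr_suml; apply: eq_bigr => j _; rewrite mxE mulrA. Qed.

Let th_sphere : th @^-1` (@sphere R n) = D.
Proof.
apply/seteqP; split => w; rewrite /sphere /=.
  move=> H; apply/eqP => Zw; move: H; rewrite inner_th Zw invr0 mulr0.
  by move/eqP; rewrite eq_sym oner_eq0.
move=> Zw; rewrite inner_th /Y.
have Z2 : \sum_j X j w ^+ 2 = Z w ^+ 2.
  by rewrite sqr_sqrtr//; apply: sumr_ge0 => j _; exact: sqr_ge0.
under eq_bigr do rewrite mxE mulrAC -expr2.
have Zn : Z w != 0 by exact: Zw.
by rewrite -mulr_suml Z2 expr2 mulfK// divff.
Qed.

Let thm : {mfun T >-> borel_rV R n} :=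
  HB.pack (th : T -> borel_rV R n) (isMeasurableFun.Build _ _ T (borel_rV R n) th mth).

Let rhoV_ge0 : 0 <= rho^-1.
Proof. by rewrite invr_ge0 ltW. Qed.

Let m0 : {measure set (borel_rV R n) -> \bar R} :=
  mscale (NngNum rhoV_ge0) (distribution P thm).

Let m0_sphere : (m0 (@sphere R n) < +oo)%E.
Proof.
rewrite /m0/= /mscale/= lte_mul_pinfty// ?lee_fin//.
by rewrite -ge0_fin_numE// fin_num_measure//; exact: measurable_sphere.
Qed.

Let mu : {finite_measure set (borel_rV R n) -> \bar R} :=
  mfrestr (@measurable_sphere R n) m0_sphere.

Let muS : mu (@sphere R n) = 1%E.
Proof.
rewrite /mu/= /mfrestr /mrestr setIid /m0/= /mscale/= /distribution /pushforward/= th_sphere PD.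
by rewrite -EFinM mulVf// gt_eqF.
Qed.

Let mu_int (f : borel_rV R n -> \bar R) : measurable_fun setT f ->
  (forall xi, sphere xi -> (0 <= f xi)%E) ->
  (\int[mu]_(xi in (@sphere R n : set (borel_rV R n))) f xi =
   (rho^-1)%:E * \int[P]_(w in D) f (th w))%E.
Proof.
move=> mf f0; have mS := @measurable_sphere R n.
transitivity (\int[m0]_(xi in (@sphere R n : set (borel_rV R n))) f xi)%E.
  apply: eq_measure_integral => B mB BS.
  by rewrite /mu/= /mfrestr /mrestr setIidl.
rewrite /m0 ge0_integral_mscale//=; last exact: measurable_funTS.
congr (_ * _)%E; rewrite /distribution ge0_integral_pushforward//.
- by rewrite th_sphere.
- exact: measurable_funTS.
- by move=> xi; rewrite inE; exact: f0.
Qed.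

Let inner_le1 x xi : l1 x <= 1 -> sphere xi -> `|inner x xi| <= 1.
Proof.
move=> x1 xiS; apply: le_trans (ler_norm_sum _ _ _) _; apply: le_trans x1.
apply: ler_sum => j _; rewrite normrM ler_piMr//.
have : xi ord0 j ^+ 2 <= 1.
  rewrite -xiS /inner (bigD1 j)//= expr2 lerDl; apply: sumr_ge0 => i _.
  by rewrite -expr2 sqr_ge0.
by rewrite -real_normK ?num_real// expr_le1.
Qed.

Let melog x : measurable_fun setT ((fun xi => elog (inner x xi)) : borel_rV R n -> \bar R).
Proof.
apply: (measurableT_comp (f := @elog R)); first exact: measurable_elog.
by apply: measurable_borel_continuous; exact: continuous_inner.
Qed.

Let mNelog x :
  measurable_fun setT ((fun xi => (- elog (inner x xi))%E) : borel_rV R n -> \bar R).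
Proof. by apply: measurableT_comp (melog x) => //; exact: oppe_measurable. Qed.

Let elog_le0 (t : R) : `|t| <= 1 -> (0 <= - elog t)%E.
Proof.
move=> t1; rewrite /elog; case: ifPn => // tn0.
by rewrite -EFinN lee_fin oppr_ge0 ln_le0.
Qed.

Let int_elog_small x : x != 0 -> l1 x <= 1 ->
  (\int[mu]_(xi in (@sphere R n : set (borel_rV R n))) (- elog (inner x xi)) =
   (rho^-1)%:E * Lam x)%E.
Proof.
move=> xn0 x1; rewrite mu_int.
- congr (_ * _)%E; rewrite integral_mkcond; apply: eq_integral => w _.
  rewrite patchE; case: ifPn => [/set_mem Dw|/negP nDw].
    by rewrite inner_th log_ratio_elog//; exact: Yle.
  rewrite /log_ratio ifT//; apply: contrapT => /negP Zw; apply: nDw.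
  by rewrite inE.
- exact: mNelog.
- by move=> xi xiS; apply: elog_le0; exact: inner_le1.
Qed.

Lemma embedding_of_random_vector : exists (mu : {finite_measure set (borel_rV R n) -> \bar R}) (C : R),
  mu (~` (@sphere R n)) = 0%E /\
  (forall x : 'rV[R]_n, x != 0 ->
     mu.-integrable (@sphere R n : set (borel_rV R n)) (fun xi => elog (inner x xi))) /\
  (forall x : 'rV[R]_n, elog (nu x) =
     (\int[mu]_(xi in (@sphere R n : set (borel_rV R n))) elog (inner x xi) + C%:E)%E).
Proof.
have [A LamA] := Lam_log; have mS := @measurable_sphere R n.
(* Dividing [Lam y = A - rho * ln (nu y)] by [rho] leaves this constant. *)
exists mu, (rho^-1 * A).
have scale x : x != 0 -> exists (s : R) (y : 'rV[R]_n),
    [/\ 0 < s, y != 0, l1 y <= 1 & x = s *: y].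
  move=> xn0; have l0 : 0 < l1 x.
    have [j xj] : exists j, x ord0 j != 0.
      apply: contrapT => /forallNP H; move/eqP : xn0; apply; apply/rowP => j.
      by rewrite mxE; apply/eqP; apply: contrapT => /negP; exact: H.
    rewrite /l1 (bigD1 j)//= ltr_pwDl ?normr_gt0//; exact: sumr_ge0.
  exists (l1 x), ((l1 x)^-1 *: x); split=> //.
  - by rewrite scaler_eq0 negb_or invr_eq0 gt_eqF.
  - by rewrite l1Z ?invr_ge0 ?(ltW l0)// mulVf// gt_eqF.
  - by rewrite scalerA divff ?scale1r// gt_eqF.
have elogZ (s : R) y xi : 0 < s ->
    elog (inner (s *: y) xi) = ((ln s)%:E - - elog (inner y xi))%E.
  move=> s0; have -> : inner (s *: y) xi = s * inner y xi.
    by rewrite /inner mulr_sumr; apply: eq_bigr => j _; rewrite !mxE mulrA.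
  rewrite /elog mulf_eq0 (gt_eqF s0)/=; case: ifPn => //= yn0.
  by rewrite opprK -EFinD normrM (gtr0_norm s0) lnM ?posrE ?normr_gt0.
have intg y : y != 0 -> l1 y <= 1 ->
    mu.-integrable (@sphere R n : set (borel_rV R n)) (fun xi => (- elog (inner y xi))%E).
  move=> yn0 y1; apply/integrableP; split.
    by apply: measurable_funTS; exact: mNelog.
  rewrite (eq_integral (fun xi : borel_rV R n => (- elog (inner y xi))%E)).
    by rewrite int_elog_small// LamA// -EFinM ltry.
  by move=> xi /set_mem xiS; rewrite gee0_abs//; apply: elog_le0; exact: inner_le1.
have intc (s : R) :
    mu.-integrable (@sphere R n : set (borel_rV R n)) (fun=> s%:E).
  by apply: finite_measure_integrable_cst.
split; [|split].
- by rewrite /mu/= /mfrestr /mrestr setICl measure0.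
- move=> x xn0; have [s [y [s0 yn0 y1 ->]]] := scale x xn0.
  under eq_fun do rewrite elogZ//.
  by apply: integrableB => //; exact: intg.
(* At [x = 0] both sides are [-oo], since the integrand is constantly [-oo] on a sphere of mass
   1. *)
- move=> x; have [->|xn0] := eqVneq x 0.
    rewrite nu0 /elog eqxx.
    rewrite (eq_integral (cst -oo%E)) => [|xi _]; last first.
      rewrite /inner big1 ?eqxx// => j _; by rewrite mxE mul0r.
    by rewrite integral_cst// [X in (_ * X)%E](_ : _ = 1%E) ?mule1.
  have [s [y [s0 yn0 y1 xE]]] := scale x xn0.
  have ny := nu_gt0 yn0.
  rewrite xE nuZ//; under eq_integral do rewrite elogZ//.
  rewrite integralB//; last exact: intg.
  rewrite int_elog_small// LamA// integral_cst// [X in (_ * X)%E](_ : _ = 1%E)//.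
  rewrite mule1 /elog mulf_eq0 !gt_eqF//= gtr0_norm ?mulr_gt0// lnM ?posrE//.
  rewrite -!EFinD; congr _%:E.
  by field; rewrite gt_eqF.
Qed.

End embedding.

(** * The Minkowski functional *)

Section minkowski.
Context {R : realType} {n : nat} (K : set 'rV[R]_n).
Hypotheses (bK : bounded_set K) (K0 : interior K 0) (KN : origin_symmetric K).
Local Notation nu := (minkowski_functional K).
Local Notation dilations x := [set s : R | 0 <= s /\ exists2 y, K y & x = s *: y].

Let dilations_lb x : lbound (dilations x) 0.
Proof. by move=> s []. Qed.

Let dilations_neq0 x : dilations x !=set0.
Proof.
have : \forall s \near +oo, K (s^-1 *: x).
  have cv : (fun s : R => s^-1 *: x) @ +oo --> (0 : 'rV[R]_n).
    rewrite -[X in _ --> X](scale0r x); apply: cvgZr_tmp.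
    apply/gtr0_cvgV0; last exact: cvg_id.
  exact: nbhs_pinfty_gt.
  exact: cv.
move=> near_x.
have [s [sK s0]] : exists s, K (s^-1 *: x) /\ 0 < s.
  near (@pinfty_nbhs R) => s; exists s; split; near: s => //.
  exact: nbhs_pinfty_gt.
by exists s; split; [exact: ltW|exists (s^-1 *: x) => //; rewrite scalerA divff ?scale1r// gt_eqF].
Unshelve. all: by end_near. Qed.

Let nu_le s x y : 0 <= s -> K y -> x = s *: y -> nu x <= s.
Proof. by move=> s0 Ky xE; apply: ge_inf; [exists 0|split=> //; exists y]. Qed.

Let le_nu b x : (forall s y, 0 <= s -> K y -> x = s *: y -> b <= s) -> b <= nu x.
Proof. by move=> H; apply: lb_le_inf => // s [s0 [y Ky xE]]; exact: H xE. Qed.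

Let le_nuZ c x : 0 < c -> nu (c *: x) <= c * nu x.
Proof.
move=> c0; rewrite -ler_pdivrMl//; apply: le_nu => s y s0 Ky ->.
by rewrite ler_pdivrMl//; apply: (nu_le _ Ky); rewrite ?mulr_ge0 ?(ltW c0)// scalerA.
Qed.

Lemma minkowskiZ c x : 0 < c -> nu (c *: x) = c * nu x.
Proof.
move=> c0; apply/eqP; rewrite eq_le le_nuZ//= -ler_pdivlMl//.
have ci : 0 < c^-1 by rewrite invr_gt0.
by apply: le_trans (le_nuZ _ ci); rewrite scalerA mulVf ?scale1r// gt_eqF.
Qed.

Lemma minkowskiN x : nu (- x) = nu x.
Proof.
have KNy y : K y -> K (- y) by move=> Ky; rewrite -KN; exists y.
suff H z : nu (- z) <= nu z.
  by apply/eqP; rewrite eq_le H/=; rewrite -{1}[x]opprK.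
apply: le_nu => s y s0 Ky ->; apply: (nu_le s0 (KNy _ Ky)).
by rewrite scalerN.
Qed.

Lemma minkowski0 : nu 0 = 0.
Proof.
apply/eqP; rewrite eq_le; apply/andP; split; last exact: le_nu.
by apply: (@nu_le 0 0 0) => //; [exact: interior_subset|rewrite scaler0].
Qed.

Lemma minkowski_gt0 x : x != 0 -> 0 < nu x.
Proof.
move=> xn0; have [B [_ /(_ (`|B| + 1))]] := bK.
rewrite (le_lt_trans (ler_norm _)) ?ltrDl// => /(_ isT) KB.
have B0 : 0 < `|B| + 1 by rewrite ltr_wpDl.
apply: (@lt_le_trans _ _ (`|x| / (`|B| + 1))); first by rewrite divr_gt0// normr_gt0.
apply: le_nu => s y s0 Ky ->; rewrite normrZ ger0_norm// ler_pdivrMr//.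
by rewrite ler_wpM2l//; exact: KB.
Qed.

End minkowski.

(** * Normalisation of the positive definite function and conclusion *)

Section positive_definite_bounds.
Context {R : realType} {n : nat}.

(** Use the two points [x] and 0 with coefficients [cis al] and 1; the phases 0 and [pi] give the
    two signs. *)
Lemma positive_definite_le (phi : 'rV[R]_n -> R) x :
  (forall y, phi (- y) = phi y) ->
  positive_definite (fun y => real_complex R (phi y)) -> `|phi x| <= phi 0.
Proof.
move=> phiN /positive_definite_cos pd.
have H al := pd bool (fun b => if b then x else 0) (fun b => if b then al else 0).
have := H 0; have := H pi.
rewrite !big_bool/= !subrr !subr0 !sub0r phiN !(cosN, oppr0, cos0, cospi).
by rewrite ler_norml => ? ?; apply/andP; split; lra.
Qed.

Lemma positive_definite_scale (phi : 'rV[R]_n -> R) c : 0 <= c ->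
  positive_definite (fun y => real_complex R (phi y)) ->
  positive_definite (fun y => real_complex R (c * phi y)).
Proof.
move=> c0 pd m x a; rewrite (_ : \sum_i _ = real_complex R c *
    \sum_(i < m) \sum_(j < m) a i * (a j)^* * real_complex R (phi (x i - x j))).
  by rewrite mulr_ge0// lecR.
rewrite mulr_sumr; apply: eq_bigr => i _; rewrite mulr_sumr; apply: eq_bigr => j _.
by rewrite rmorphM/= mulrCA.
Qed.

End positive_definite_bounds.

Theorem theorem1 (R : realType) (n : nat) (K : set 'rV[R]_n) :
  (2 <= n)%N ->
  star_body K -> origin_symmetric K ->
  (exists f : R -> R,
      (forall t, f (- t) = f t) /\
      (exists a b, f a != f b) /\
      continuous f /\
      positive_definite (fun x : 'rV[R]_n => real_complex R (f (minkowski_functional K x)))) ->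
  embeds_in_L0 K.
Proof.
move=> n2 [_ bK _ K0 cnu] KN [f [fN [[a [b fab]] [cf pd]]]].
pose nu := minkowski_functional K.
have nuZ c x : 0 < c -> nu (c *: x) = c * nu x by exact: minkowskiZ.
have nuN x : nu (- x) = nu x by exact: minkowskiN.
have nu0 : nu 0 = 0 by exact: minkowski0.
have nu_gt0 x : x != 0 -> 0 < nu x by exact: minkowski_gt0.
(* Along a ray [nu] takes every positive value and [f] is even, so a constant [f (nu x)] would make
   [f] constant. *)
have f_nonconst c : ~ forall x, f (nu x) = c.
  move=> H; have n0 : (0 < n)%N by exact: ltnW.
  pose e : 'rV[R]_n := delta_mx ord0 (Ordinal n0).
  have en0 : e != 0.
    by apply/eqP => /rowP/(_ (Ordinal n0)); rewrite !mxE !eqxx => /eqP; rewrite oner_eq0.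
  have fc t : 0 < t -> f t = c.
    move=> t0; rewrite -(H ((t / nu e) *: e)) nuZ; last by rewrite divr_gt0 ?nu_gt0.
    by rewrite divfK// gt_eqF// nu_gt0.
  have {}fc t : f t = c.
    have [t0|t0|->] := ltgtP t 0; first by rewrite -fN fc// oppr_gt0.
    - exact: fc.
    - by rewrite -nu0 H.
  by move/eqP: fab; rewrite !fc.
have bound x : `|f (nu x)| <= f 0.
  by rewrite -nu0; apply: (positive_definite_le x _ pd) => y; congr f; exact: nuN.
have f0 : 0 < f 0.
  rewrite lt0r (le_trans _ (bound 0))// andbT; apply/eqP => f00.
  apply: (f_nonconst 0) => x; apply/eqP; rewrite -normr_le0 -f00; exact: bound.
pose phi x := (f 0)^-1 * f (nu x).
have phi0 : phi 0 = 1 by rewrite /phi nu0 mulVf// gt_eqF.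
have phiN x : phi (- x) = phi x by rewrite /phi nuN.
have cphi : continuous phi.
  move=> x; apply: (@cvgMl_tmp _ _ (nbhs x)).
  apply: (@cvg_comp _ _ _ nu f _ (nbhs (nu x))); [exact: cnu|exact: cf].
have pdphi : positive_definite (fun x => real_complex R (phi x)).
  by apply: positive_definite_scale pd; rewrite invr_ge0 ltW.
have [d [T [P [X [mX EX]]]]] := bochner phi0 phiN cphi pdphi.
pose Z w := Num.sqrt (\sum_j X j w ^+ 2).
apply: (@embedding_of_random_vector _ _ _ _ P X nu) => //.
(* The scaling rule for [nu] concerns positive factors, so [t = 0] is treated apart. *)
- move=> x y xy t; rewrite le_eqVlt => /predU1P[<-|t0].
    by under eq_integral do rewrite mul0r; under [RHS]eq_integral do rewrite mul0r.
  have E (z : 'rV[R]_n) : (\int[P]_w (1 - cos (t * \sum_j z ord0 j * X j w))%:E = (1 - phi (t *: z))%:E)%E.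
    rewrite -EX; apply: eq_integral => w _; congr (1 - cos _)%:E.
    by rewrite mulr_sumr; apply: eq_bigr => j _; rewrite !mxE mulrA.
  by rewrite !E /phi !nuZ// xy.
(* If the vector vanished almost surely, the cosine formula would give [phi x = 1], that is
   [f (nu x) = f 0], for every [x]. *)
- apply/eqP => PZ0; apply: (f_nonconst (f 0)) => x.
  have mmZ : measurable_fun setT Z.
    apply: (measurableT_comp (f := @Num.sqrt R)).
      by apply: continuous_measurable_fun; exact: sqrt_continuous.
    by apply: measurable_sum => j; exact: measurable_funX.
  have mZ : measurable [set w | Z w != 0].
    rewrite (_ : [set w | _] = setT `&` Z @^-1` (~` [set 0])).
      apply: mmZ => //; apply: measurableC; exact: measurable_set1.
    by rewrite setTI; apply/seteqP; split=> w /= /eqP.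
  have : (\int[P]_w (1 - cos (\sum_j x ord0 j * X j w))%:E = 0)%E.
    rewrite -(integral0 P setT); apply: ae_eq_integral => //.
    + apply/measurable_EFinP; apply: measurable_funB => //; apply: measurableT_comp.
        by apply: continuous_measurable_fun; exact: continuous_cos.
      by apply: measurable_sum => j; exact: measurable_funM.
    + exists [set w | Z w != 0]; split=> // w /= H; apply/eqP => Zw; apply: H => _.
      rewrite big1 ?cos0 ?subrr// => j _.
      have : \sum_j X j w ^+ 2 == 0.
        by rewrite eq_le sumr_ge0 ?andbT => [|i _]; [rewrite -sqrtr_eq0; apply/eqP|exact: sqr_ge0].
      rewrite psumr_eq0 => [/allP/(_ j)|i _]; last exact: sqr_ge0.
      by rewrite mem_index_enum sqrf_eq0 => /(_ isT)/eqP ->; rewrite mulr0.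
  rewrite EX => -[] /eqP; rewrite subr_eq0 /phi eq_sym mulrC => /eqP.
  by move/(canRL (divfK _)); rewrite mul1r gt_eqF// => /(_ isT).
Qed.
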